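(* Let $A$ and $B$ be non-trivial groups. If $A$ is a recursively presented group in which the conjugacy problem is solvable and $B$ is a finitely generated abelian group that acts on a set $S$ transitively, then the conjugacy problem is solvable in the permutational restricted wreath product $A\wr_S B$.
   Context: A group is recursively presented if it has a presentation with finitely many generators and a recursively enumerable set of relators. Elements are given as words in the generators. The conjugacy problem is solvable if an algorithm decides, for any two words in the generators, whether they represent conjugate elements. $B$ acts on $S$ on the right; fix $s_0\in S$ with stabiliser $H$, so $S=B/H$ (right cosets). The permutational restricted wreath product is $A\wr_S B=\{(b,f): b\in B,\ f\in A^{(S)}\}$, where $A^{(S)}$ is the group (pointwise multiplication) of functions $f:S\to A$ with finite support, $f^{c}(s)=f(sc^{-1})$, and $(b,f)(c,g)=(bc,f^{c}g)$. It is generated by the elements $(b,1)$ with $b$ a generator of $B$ and $(1_B,a^{(s_0)})$ with $a$ a generator of $A$, where $a^{(s)}$ takes the value $a$ at $s$ and $1_A$ elsewhere. *)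

(* Defs.v *)
From HB Require Import structures.
From mathcomp Require Import all_boot.
From mathcomp Require Import finmap.

Set Implicit Arguments.
Unset Strict Implicit.
Unset Printing Implicit Defensive.

Local Open Scope group_scope.

(* The total mu-recursive functions: minimization is only applied to regular
   functions, i.e. when a zero of g exists for every value of the parameters.
   The composite, primitive recursive and minimizing functions are specified by
   their defining equations. *)
Inductive recursive : forall n, (n.-tuple nat -> nat) -> Prop :=
| rec_zero n : recursive (fun _ : n.-tuple nat => 0%N)
| rec_succ : recursive (fun v : 1.-tuple nat => (thead v).+1)
| rec_proj n (i : 'I_n) : recursive (fun v : n.-tuple nat => tnth v i)
| rec_comp n k (f : k.-tuple nat -> nat) (g : 'I_k -> n.-tuple nat -> nat)
    (h : n.-tuple nat -> nat) :
    recursive f -> (forall i, recursive (g i)) ->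
    (forall v, h v = f [tuple g i v | i < k]) -> recursive h
| rec_prim n (f : n.-tuple nat -> nat) (g : n.+2.-tuple nat -> nat)
    (h : n.+1.-tuple nat -> nat) :
    recursive f -> recursive g ->
    (forall v : n.-tuple nat, h (cons_tuple 0%N v) = f v) ->
    (forall k (v : n.-tuple nat),
        h (cons_tuple k.+1 v) =
        g (cons_tuple k (cons_tuple (h (cons_tuple k v)) v))) ->
    recursive h
| rec_min n (g : n.+1.-tuple nat -> nat) (h : n.-tuple nat -> nat) :
    recursive g ->
    (forall v : n.-tuple nat, g (cons_tuple (h v) v) = 0%N) ->
    (forall (v : n.-tuple nat) m,
        (m < h v)%N -> g (cons_tuple m v) <> 0%N) ->
    recursive h.

(* The letter (i, false) stands for the i-th generator, (i, true) for its
   inverse. *)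
Definition word (n : nat) : Type := seq ('I_n * bool).

Definition word_code n (w : word n) : nat :=
  CodeSeq.code [seq (l.1.*2 + l.2)%N | l : 'I_n * bool <- w].

(* Values of f that are not codes of words are ignored; in particular the empty
   set is recursively enumerable. *)
Definition recursively_enumerable n (R : word n -> Prop) : Prop :=
  exists f : 1.-tuple nat -> nat,
    recursive f /\
    forall w, R w <-> exists k, f [tuple k] = word_code w.

Definition decidable_relation n (P : word n -> word n -> Prop) : Prop :=
  exists f : 2.-tuple nat -> nat,
    recursive f /\
    forall u v,
      (P u v -> f [tuple word_code u; word_code v] = 1%N) /\
      (~ P u v -> f [tuple word_code u; word_code v] = 0%N).

Definition weval (G : groupType) n (g : 'I_n -> G) (w : word n) : G :=
  foldr (fun l x => (if l.2 then (g l.1)^-1 else g l.1) * x) 1 w.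

Definition generates (G : groupType) n (g : 'I_n -> G) : Prop :=
  forall x : G, exists w, weval g w = x.

(* Equality of words in the group < x_0, ..., x_(n-1) | R >. *)
Inductive presented_eq n (R : word n -> Prop) : word n -> word n -> Prop :=
| peq_refl u : presented_eq R u u
| peq_sym u v : presented_eq R u v -> presented_eq R v u
| peq_trans u v w :
    presented_eq R u v -> presented_eq R v w -> presented_eq R u w
| peq_cat u u' v v' :
    presented_eq R u u' -> presented_eq R v v' ->
    presented_eq R (u ++ v) (u' ++ v')
| peq_cancel i e : presented_eq R [:: (i, e); (i, ~~ e)] [::]
| peq_relator r : R r -> presented_eq R r [::].

Definition presentation (G : groupType) n (g : 'I_n -> G)
    (R : word n -> Prop) : Prop :=
  generates g /\ forall u v, weval g u = weval g v <-> presented_eq R u v.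

Definition recursively_presented (G : groupType) : Prop :=
  exists (n : nat) (g : 'I_n -> G) (R : word n -> Prop),
    presentation g R /\ recursively_enumerable R.

Definition conjugate (G : groupType) (x y : G) : Prop := exists z : G, y = x ^ z.

Definition conjugacy_problem_solvable (G : groupType) n (g : 'I_n -> G) : Prop :=
  generates g /\
  decidable_relation (fun u v => conjugate (weval g u) (weval g v)).

Record right_action (B : groupType) (S : Type) := RightAction {
  ract :> S -> B -> S;
  ract1 : forall s, ract s 1 = s;
  ractM : forall s b c, ract s (b * c) = ract (ract s b) c
}.

Definition transitive_action (B : groupType) (S : Type)
    (to : right_action B S) : Prop :=
  forall s t, exists b, to s b = t.

Notation fsupp_fun S A := {fsfun S -> A for fun=> 1}.

(* An alias carrying the action, so that the group law below is canonical. *)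
Definition wreath (A B : groupType) (S : choiceType)
    (to : right_action B S) : Type := (B * fsupp_fun S A)%type.

Section Wreath.
Variables (A B : groupType) (S : choiceType) (to : right_action B S).
Implicit Types (f g h : fsupp_fun S A) (b c : B) (s : S) (x y z : wreath A to).

HB.instance Definition _ := Choice.on (wreath A to).

Definition fsmul f g : fsupp_fun S A :=
  [fsfun s in (finsupp f `|` finsupp g)%fset => f s * g s | 1].

Definition fsinv f : fsupp_fun S A :=
  [fsfun s in finsupp f => (f s)^-1 | 1].

Definition fstrans f c : fsupp_fun S A :=
  [fsfun s in [fset to t c | t in finsupp f]%fset => f (to s c^-1) | 1].

Lemma ractK c : cancel (to^~ c) (to^~ c^-1).
Proof. by move=> s; rewrite -ractM mulgV ract1. Qed.

Lemma ractKV c : cancel (to^~ c^-1) (to^~ c).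
Proof. by move=> s; rewrite -ractM mulVg ract1. Qed.

Lemma fsmulE f g s : fsmul f g s = f s * g s.
Proof.
rewrite fsfunE inE; case: ifPn => // /norP[nf ng].
by rewrite !fsfun_dflt // mulg1.
Qed.

Lemma fsinvE f s : fsinv f s = (f s)^-1.
Proof. by rewrite fsfunE; case: ifPn => // nf; rewrite fsfun_dflt // invg1. Qed.

Lemma fstransE f c s : fstrans f c s = f (to s c^-1).
Proof.
rewrite fsfunE; case: ifPn => // nf; rewrite fsfun_dflt //.
by apply: contra nf => fs; apply/imfsetP; exists (to s c^-1); rewrite ?ractKV.
Qed.

Definition wreath_mul x y : wreath A to := (x.1 * y.1, fsmul (fstrans x.2 y.1) y.2).
Definition wreath_one : wreath A to := (1, [fsfun]).
Definition wreath_inv x : wreath A to := (x.1^-1, fsinv (fstrans x.2 x.1^-1)).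

Lemma wreath_mulA : associative wreath_mul.
Proof.
move=> x y z; congr pair; first exact: mulgA.
by apply/fsfunP => s; rewrite !(fsmulE, fstransE) /= mulgA invgM ractM.
Qed.

Lemma wreath_mul1g : left_id wreath_one wreath_mul.
Proof.
case=> b f; congr pair; first exact: mul1g.
by apply/fsfunP => s; rewrite !(fsmulE, fstransE) /= fsfun0E mul1g.
Qed.

Lemma wreath_mulg1 : right_id wreath_one wreath_mul.
Proof.
case=> b f; congr pair; first exact: mulg1.
by apply/fsfunP => s; rewrite !(fsmulE, fstransE) /= fsfun0E invg1 ract1 mulg1.
Qed.

Lemma wreath_mulVg : left_inverse wreath_one wreath_inv wreath_mul.
Proof.
case=> b f; congr pair; first exact: mulVg.
apply/fsfunP => s; rewrite !(fsmulE, fsinvE, fstransE) /= fsfun0E.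
by rewrite invgK ractKV mulVg.
Qed.

Lemma wreath_mulgV : right_inverse wreath_one wreath_inv wreath_mul.
Proof.
case=> b f; congr pair; first exact: mulgV.
apply/fsfunP => s; rewrite !(fsmulE, fsinvE, fstransE) /= fsfun0E.
by rewrite mulgV.
Qed.

HB.instance Definition _ := isGroup.Build (wreath A to)
  wreath_mulA wreath_mul1g wreath_mulg1 wreath_mulVg wreath_mulgV.

Definition fssingle s (a : A) : fsupp_fun S A :=
  [fsfun t in [fset s]%fset => a | 1].

Definition wreath_base b : wreath A to := (b, [fsfun]).
Definition wreath_lamp s (a : A) : wreath A to := (1, fssingle s a).

Definition wreath_gens m n (gA : 'I_m -> A) (gB : 'I_n -> B) (s0 : S)
    (i : 'I_(n + m)) : wreath A to :=
  match split i with
  | inl j => wreath_base (gB j)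
  | inr j => wreath_lamp s0 (gA j)
  end.

End Wreath.

(* Main.v *)
Require Import Defs.
From mathcomp Require Import all_boot all_order all_algebra finmap.
From mathcomp Require Import boolp zify ring.

(* For abelian B, the elements (b, f) and (c, g) are conjugate iff b = c and,
   for some d in B and some h in A^(S), f^d(sb) h(sb) = h(s) g(sb) for all s.
   This equation splits along the orbits of b on S, which all have the same
   length: on finite orbits it is solvable iff the products of f^d and g along
   the orbit are conjugate in A, and on infinite orbits iff these products are
   equal.  Only finitely many d matter, because a nontrivial orbit of f has to
   be moved onto one of g.  Everything is decidable once membership in the
   stabiliser of s0 is, together with the order of b modulo the stabiliser and
   a bound for the exponents k such that w b^k fixes s0; these are read off a
   finite system of congruences that defines the stabiliser inside Z^n. *)

Set Implicit Arguments.
Unset Strict Implicit.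
Unset Printing Implicit Defensive.

(** * Recursive functions *)

(** The congruences and the constants derived from them are only shown to exist. They are hard-wired
    into one fixed recursive function, the weights of the letters through finite lookup tables, and
    words in the generators of B are handled through their exponent vectors. The orbits of b have
    equal length because in a transitive action of an abelian group all point stabilisers coincide.
    The contrast between the two kinds of orbits comes from the finite support of h. Along an orbit,
    one value z of h determines all the others. On a cycle z is free, and going round once imposes a
    single relation x z = z y in A. On an infinite orbit h has to be 1 far out in both directions,
    where f and g are trivial, so z = 1 and x = y. Powers of b drop out of the choice of d because f
    is always cohomologous to its translate by b, through h = f^-1. *)

Notation coord n i := (fun v : n.-tuple nat => tnth v (@Ordinal n i isT)).

(** [rec_comp] asks only for a pointwise equality, so composing [f] with the projections transfers
    recursiveness between functions that agree at every tuple. *)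
Lemma recursive_ext n (f h : n.-tuple nat -> nat) :
  recursive f -> h =1 f -> recursive h.
Proof.
move=> rf e; apply: (rec_comp rf (g := fun i v => tnth v i)).
  by move=> i; apply: rec_proj.
by move=> v; rewrite e; congr f; apply: eq_from_tnth => i; rewrite tnth_mktuple.
Qed.

Definition recursive1 (op : nat -> nat) :=
  recursive (fun v : 1.-tuple nat => op (coord 1 0 v)).

Definition recursive2 (op : nat -> nat -> nat) :=
  recursive (fun v : 2.-tuple nat => op (coord 2 0 v) (coord 2 1 v)).

Lemma recursive_app1 n op (f : n.-tuple nat -> nat) :
  recursive1 op -> recursive f -> recursive (fun v => op (f v)).
Proof.
move=> rop rf; apply: (rec_comp rop (g := fun _ v => f v)) => // v.
by rewrite tnth_mktuple.
Qed.

Lemma recursive_app2 n op (f g : n.-tuple nat -> nat) :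
  recursive2 op -> recursive f -> recursive g ->
  recursive (fun v => op (f v) (g v)).
Proof.
move=> rop rf rg.
apply: (rec_comp rop (g := fun i v => if i == ord0 then f v else g v)).
  by move=> i; case: (i == ord0).
by move=> v; rewrite !tnth_mktuple.
Qed.

Lemma recursive_const n c : recursive (fun _ : n.-tuple nat => c).
Proof.
elim: c => [|c IHc]; first exact: rec_zero.
apply: (recursive_app1 (op := S)) IHc.
by apply: recursive_ext rec_succ _ => v; rewrite /thead !(tnth_nth 0).
Qed.

Lemma recursive1_succ : recursive1 S.
Proof. by apply: recursive_ext rec_succ _ => v; rewrite /thead !(tnth_nth 0). Qed.

Lemma recursive2_nat_rect (f : nat -> nat) (g : nat -> nat -> nat -> nat) :
  recursive1 f ->
  recursive (fun v : 3.-tuple nat => g (coord 3 0 v) (coord 3 1 v) (coord 3 2 v)) ->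
  recursive2 (fun k x => nat_rect _ (f x) (fun j r => g j r x) k).
Proof.
move=> rf rg; apply: (rec_prim rf rg) => [v|k v].
  by congr f; rewrite !(tnth_nth 0).
by congr g; rewrite !(tnth_nth 0).
Qed.

Lemma recursive2_iter (f : nat -> nat) (g : nat -> nat -> nat) :
  recursive1 f -> recursive2 g ->
  recursive2 (fun k x => iter k (fun r => g r x) (f x)).
Proof.
move=> rf rg; apply: recursive_ext (recursive2_nat_rect (g := fun _ r x => g r x) rf _) _.
  by apply: recursive_app2 => //; apply: rec_proj.
by move=> v; elim: (coord 2 0 v) => //= k ->.
Qed.

Lemma recursive2_rec (op : nat -> nat -> nat) (f : nat -> nat)
    (g : nat -> nat -> nat -> nat) :
  recursive1 f ->
  recursive (fun v : 3.-tuple nat => g (coord 3 0 v) (coord 3 1 v) (coord 3 2 v)) ->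
  (forall x, op 0 x = f x) -> (forall k x, op k.+1 x = g k (op k x) x) ->
  recursive2 op.
Proof.
move=> rf rg op0 opS; apply: recursive_ext (recursive2_nat_rect rf rg) _ => v.
by elim: (coord 2 0 v) => [|k IHk]; rewrite ?op0 //= opS IHk.
Qed.

Lemma recursive1_id : recursive1 id.
Proof. exact: rec_proj. Qed.

Lemma recursive1_const c : recursive1 (fun=> c).
Proof. exact: recursive_const. Qed.

Lemma recursive2_swap op : recursive2 op -> recursive2 (fun x y => op y x).
Proof. by move=> rop; apply: (recursive_app2 rop); apply: rec_proj. Qed.

Lemma recursive1_app1 op f : recursive1 op -> recursive1 f -> recursive1 (op \o f).
Proof. exact: recursive_app1. Qed.

Lemma recursive1_app2 op f g :
  recursive2 op -> recursive1 f -> recursive1 g -> recursive1 (fun x => op (f x) (g x)).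
Proof. exact: recursive_app2. Qed.

Lemma recursive2_diag op : recursive2 op -> recursive1 (fun x => op x x).
Proof. by move=> rop; apply: recursive1_app2 rop _ _; apply: recursive1_id. Qed.

Lemma recursive2_addn : recursive2 addn.
Proof.
apply: (recursive2_rec (f := id) (g := fun _ r _ => r.+1)) => //.
  exact: recursive1_id.
exact: recursive_app1 recursive1_succ (rec_proj _).
Qed.

Lemma recursive2_muln : recursive2 muln.
Proof.
apply: (recursive2_rec (f := fun=> 0) (g := fun _ r x => x + r)) => //.
  exact: recursive1_const.
by apply: recursive_app2 recursive2_addn _ _; apply: rec_proj.
Qed.

Lemma recursive1_pred : recursive1 predn.
Proof.
apply: (recursive2_diag (op := fun x _ => x.-1)).
by apply: (recursive2_rec (f := fun=> 0) (g := fun k _ _ => k)) => //;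
  [apply: recursive1_const | apply: rec_proj].
Qed.

Lemma recursive2_subn : recursive2 subn.
Proof.
apply: (recursive2_swap (op := fun k x => x - k)).
apply: (recursive2_rec (f := id) (g := fun _ r _ => r.-1)).
- exact: recursive1_id.
- exact: recursive_app1 recursive1_pred (rec_proj _).
- exact: subn0.
- by move=> k x; rewrite subnS.
Qed.

Lemma recursive1_pow2 : recursive1 (expn 2).
Proof.
apply: (recursive2_diag (op := fun x _ => 2 ^ x)).
apply: (recursive2_rec (f := fun=> 1) (g := fun _ r _ => r + r)).
- exact: recursive1_const.
- by apply: recursive_app2 recursive2_addn _ _; apply: rec_proj.
- by [].
- by move=> k _; rewrite expnS mul2n addnn.
Qed.

Lemma recursive1_eq0 : recursive1 (fun x => x == 0).
Proof.
apply: recursive_ext (recursive_app2 recursive2_subn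
  (recursive_const 1 1) (rec_proj (@Ordinal 1 0 isT))) _.
by move=> v /=; case: (tnth _ _) => // x; rewrite subSS sub0n.
Qed.

Lemma recursive2_eqn : recursive2 (fun x y => x == y).
Proof.
apply: (recursive_ext (f := fun v : 2.-tuple nat =>
  (coord 2 0 v - coord 2 1 v) + (coord 2 1 v - coord 2 0 v) == 0)).
  apply: recursive_app1 recursive1_eq0 _.
  by apply: recursive_app2 recursive2_addn _ _;
    apply: recursive_app2 recursive2_subn _ _; apply: rec_proj.
by move=> v; rewrite addn_eq0 !subn_eq0 eqn_leq.
Qed.

Lemma recursive_if n (b f g : n.-tuple nat -> nat) :
  recursive b -> recursive f -> recursive g ->
  recursive (fun v => if b v == 0 then g v else f v).
Proof.
move=> rb rf rg.
apply: (recursive_ext (f := fun v => (b v == 0) * g v + ((b v == 0) == 0 :> nat) * f v)).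
  apply: recursive_app2 recursive2_addn _ _; apply: recursive_app2 recursive2_muln _ _ => //.
    exact: recursive_app1 recursive1_eq0 rb.
  by do 2!apply: recursive_app1 recursive1_eq0 _.
by move=> v; case: (b v == 0) => /=; rewrite ?mul1n ?mul0n ?addn0.
Qed.

Lemma recursive1_if b f g :
  recursive1 b -> recursive1 f -> recursive1 g ->
  recursive1 (fun x => if b x == 0 then g x else f x).
Proof. exact: recursive_if. Qed.

(** The remainder counts up and is reset on reaching the modulus. A modulus 0 is never reached,
    which agrees with [k %% 0 = k]; this convention later lets a congruence modulo 0 express an
    equation. *)
Lemma recursive2_modn : recursive2 modn.
Proof.
apply: (recursive2_rec (f := fun=> 0)
  (g := fun _ r d => if (r.+1 == d : nat) == 0 then r.+1 else 0)).
- exact: recursive1_const.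
- apply: recursive_if.
  + apply: recursive_app2 recursive2_eqn _ (rec_proj _).
    exact: recursive_app1 recursive1_succ (rec_proj _).
  + exact: recursive_const.
  + exact: recursive_app1 recursive1_succ (rec_proj _).
- exact: mod0n.
- move=> k [|d] /=; first by rewrite !modn0.
  rewrite -addn1 -modnDml addn1 eqSS; case: (eqVneq (k %% d.+1) d) => [->|ne] /=.
    by rewrite modnn.
  by rewrite modn_small // ltnS ltn_neqAle ne -ltnS ltn_mod.
Qed.

Lemma recursive1_odd : recursive1 odd.
Proof.
apply: recursive_ext (recursive_app2 recursive2_modn
  (rec_proj (@Ordinal 1 0 isT)) (recursive_const 1 2)) _.
by move=> v; rewrite modn2.
Qed.

Lemma recursive1_half : recursive1 half.
Proof.
apply: (recursive2_diag (op := fun x _ => x./2)).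
apply: (recursive2_rec (f := fun=> 0) (g := fun k r _ => k - r)) => //.
- exact: recursive1_const.
- by apply: recursive_app2 recursive2_subn _ _; apply: rec_proj.
- by move=> k _ /=; rewrite uphalf_half -{3}[k]odd_double_half -addnn addnA addnK.
Qed.

(* The pairing that makes [CodeSeq.code (n :: s)] the pair of [n] and the code
   of [s]. *)
Definition pairn (x y : nat) : nat := 2 ^ x * y.*2.+1.

(** The 2-adic valuation of [z]: the counter advances until [z], halved that often, is odd. On a
    pair, [z] rounds suffice because x < 2 ^ x. *)
Definition fstn (z : nat) : nat :=
  iter z (fun r => if (odd (iter r half z) : nat) == 0 then r.+1 else r) 0.

Definition sndn (z : nat) : nat := (iter (fstn z) half z)./2.

Lemma iter_half_pairn r x y : r <= x -> iter r half (pairn x y) = pairn (x - r) y.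
Proof.
elim: r => [|r IHr] ltrx; first by rewrite subn0.
have pairnS n : (pairn n.+1 y)./2 = pairn n y.
  by rewrite /pairn expnS -mulnA mul2n doubleK.
by rewrite iterS (IHr (ltnW ltrx)) -(pairnS (x - r.+1)) subnSK.
Qed.

Lemma odd_pairn x y : odd (pairn x y) = (x == 0).
Proof. by rewrite oddM oddX /= odd_double andbT orbF. Qed.

Lemma ltn_fst_pairn x y : x < pairn x y.
Proof. by rewrite (leq_trans (ltn_expl x (ltnSn 1))) // leq_pmulr. Qed.

Lemma ltn_snd_pairn x y : y < pairn x y.
Proof.
by apply: (@leq_trans y.*2.+1); rewrite ?leq_pmull ?expn_gt0 // ltnS -addnn leq_addr.
Qed.

Lemma fstnE x y : fstn (pairn x y) = x.
Proof.
rewrite /fstn; set step := fun r => _.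
suff E k : iter k step 0 = minn k x by rewrite E (minn_idPr (ltnW (ltn_fst_pairn x y))).
elim: k => [|k IHk]; first by rewrite min0n.
rewrite iterS IHk /step iter_half_pairn ?geq_minr // odd_pairn subn_eq0.
case: (leqP x k) => lekx; first by rewrite leqnn /= (minn_idPr (leqW lekx)).
by rewrite leqNgt lekx /= (minn_idPl lekx).
Qed.

Lemma sndnE x y : sndn (pairn x y) = y.
Proof.
by rewrite /sndn fstnE iter_half_pairn // subnn /pairn mul1n -[_.+1./2]/(uphalf _) uphalf_double.
Qed.

Lemma recursive2_pairn : recursive2 pairn.
Proof.
apply: recursive_app2 recursive2_muln _ _.
  exact: recursive_app1 recursive1_pow2 (rec_proj _).
apply: (recursive_ext (f := fun v : 2.-tuple nat => (coord 2 1 v + coord 2 1 v).+1)).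
  apply: recursive_app1 recursive1_succ _.
  by apply: recursive_app2 recursive2_addn _ _; apply: rec_proj.
by move=> v; rewrite addnn.
Qed.

Lemma recursive2_iter_half : recursive2 (fun r z => iter r half z).
Proof.
apply: (recursive2_iter (f := id) (g := fun r _ => r./2)); first exact: recursive1_id.
exact: recursive_app1 recursive1_half (rec_proj _).
Qed.

Lemma recursive1_fstn : recursive1 fstn.
Proof.
apply: (recursive2_diag (op := fun k z =>
  iter k (fun r => if (odd (iter r half z) : nat) == 0 then r.+1 else r) 0)).
apply: (recursive2_iter (f := fun=> 0)
  (g := fun r z => if (odd (iter r half z) : nat) == 0 then r.+1 else r)).
  exact: recursive1_const.
apply: recursive_if.
- apply: recursive_app1 recursive1_odd _.
  by apply: recursive_app2 recursive2_iter_half _ _; apply: rec_proj.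
- exact: rec_proj.
- exact: recursive_app1 recursive1_succ (rec_proj _).
Qed.

Lemma recursive1_sndn : recursive1 sndn.
Proof.
apply: recursive_app1 recursive1_half _.
apply: recursive_app2 recursive2_iter_half _ (rec_proj _).
exact: recursive1_fstn.
Qed.

Lemma recursive1_table (s : seq nat) : recursive1 (nth 0 s).
Proof.
elim: s => [|x s IHs].
  by apply: recursive_ext (recursive_const 1 0) _ => v; rewrite nth_nil.
apply: (recursive_ext (f := fun v : 1.-tuple nat =>
  if coord 1 0 v == 0 then x else nth 0 s (coord 1 0 v).-1)).
  apply: recursive_if; [exact: rec_proj| |exact: recursive_const].
  exact: recursive_app1 IHs (recursive_app1 recursive1_pred (rec_proj _)).
by move=> v; case: (tnth _ _).
Qed.

(** * Computability on encoded data *)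

Notation letter n := ('I_n * bool)%type.

Class coding (T : Type) := encode : T -> nat.
#[global] Hint Mode coding ! : typeclass_instances.

#[global] Instance coding_nat : coding nat := id.
#[global] Instance coding_bool : coding bool := nat_of_bool.
#[global] Instance coding_prod T U `{coding T} `{coding U} : coding (T * U) :=
  fun x => pairn (encode x.1) (encode x.2).
#[global] Instance coding_seq T `{coding T} : coding (seq T) :=
  foldr (fun x c => pairn (encode x) c) 0.
(* There is no instance for ['I_n], so that this one does not compete with
   [coding_prod]. *)
#[global] Instance coding_letter n : coding (letter n) := fun l => l.1.*2 + l.2.

(** Only the values of [g] at codes matter, so no program ever has to recognise whether a number is
    a code. *)
Definition computable T U `{coding T} `{coding U} (f : T -> U) : Prop :=
  exists2 g, recursive1 g & forall x, g (encode x) = encode (f x).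

(** Connects the internal coding of lists with the [word_code] in which the decision problems are
    stated. *)
Lemma encode_word n (w : seq (letter n)) : encode w = word_code w.
Proof.
by elim: w => // l w IHw; rewrite [LHS]/(pairn (encode l) (encode w)) IHw.
Qed.

Section Basic.
Context {X T U V : Type} `{coding X} `{coding T} `{coding U} `{coding V}.

Lemma computable_ext (f g : T -> U) : computable f -> g =1 f -> computable g.
Proof. by case=> h rh hE e; exists h => // x; rewrite e hE. Qed.

Lemma computable_id : computable (fun x : T => x).
Proof. by exists id; first exact: recursive1_id. Qed.

Lemma computable_const (c : U) : computable (fun _ : T => c).
Proof. by exists (fun=> encode c); first exact: recursive1_const. Qed.

Lemma computable_comp (f : T -> U) (g : X -> T) :
  computable f -> computable g -> computable (fun x => f (g x)).
Proof.
case=> f' rf fE [g' rg gE]; exists (f' \o g'); first exact: recursive1_app1.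
by move=> x /=; rewrite gE fE.
Qed.

Lemma computable_pair (f : X -> T) (g : X -> U) :
  computable f -> computable g -> computable (fun x => (f x, g x)).
Proof.
case=> f' rf fE [g' rg gE]; exists (fun n => pairn (f' n) (g' n)).
  exact: recursive1_app2 recursive2_pairn rf rg.
by move=> x; rewrite fE gE.
Qed.

Lemma computable_fst (f : X -> T * U) : computable f -> computable (fun x => (f x).1).
Proof.
case=> f' rf fE; exists (fstn \o f'); first exact: recursive1_app1 recursive1_fstn rf.
by move=> x /=; rewrite fE fstnE.
Qed.

Lemma computable_snd (f : X -> T * U) : computable f -> computable (fun x => (f x).2).
Proof.
case=> f' rf fE; exists (sndn \o f'); first exact: recursive1_app1 recursive1_sndn rf.
by move=> x /=; rewrite fE sndnE.
Qed.

Lemma computable_nat2 (op : nat -> nat -> nat) (f g : X -> nat) :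
  recursive2 op -> computable f -> computable g -> computable (fun x => op (f x) (g x)).
Proof.
move=> rop [f' rf fE] [g' rg gE]; exists (fun n => op (f' n) (g' n)).
  exact: recursive1_app2.
by move=> x; rewrite fE gE.
Qed.

Lemma computable_eqn (f g : X -> nat) :
  computable f -> computable g -> computable (fun x => f x == g x).
Proof.
move=> [f' rf fE] [g' rg gE]; exists (fun n => f' n == g' n).
  exact: recursive1_app2 recursive2_eqn rf rg.
by move=> x; rewrite fE gE.
Qed.

Lemma computable_if (b : X -> bool) (f g : X -> U) :
  computable b -> computable f -> computable g ->
  computable (fun x => if b x then f x else g x).
Proof.
move=> [b' rb bE] [f' rf fE] [g' rg gE].
exists (fun n => if b' n == 0 then g' n else f' n); first exact: recursive_if.
by move=> x; rewrite bE fE gE; case: (b x).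
Qed.

Lemma computable_encode (f : X -> T) :
  computable f -> computable (fun x => encode (f x) : nat).
Proof. by case=> f' rf fE; exists f'. Qed.

Lemma computable_iter (k : X -> nat) (f : X -> U -> U) (z : X -> U) :
  computable k -> computable (fun p : X * U => f p.1 p.2) -> computable z ->
  computable (fun x => iter (k x) (f x) (z x)).
Proof.
move=> [k' rk kE] [f' rf fE] [z' rz zE].
exists (fun n => iter (k' n) (fun r => f' (pairn n r)) (z' n)).
  apply: (recursive1_app2 (op := fun k n => iter k (fun r => f' (pairn n r)) (z' n))) => //.
    apply: (recursive2_iter (g := fun r n => f' (pairn n r))) => //.
    by apply: recursive_app1 rf _; apply: recursive2_swap recursive2_pairn.
  exact: recursive1_id.
move=> x; rewrite kE zE -[encode (k x)]/(k x).
by elim: (k x) => //= j ->; rewrite -(fE (x, _)).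
Qed.

Lemma computable_cons (f : X -> T) (s : X -> seq T) :
  computable f -> computable s -> computable (fun x => f x :: s x).
Proof.
case=> f' rf fE [s' rs sE]; exists (fun n => pairn (f' n) (s' n)).
  exact: recursive1_app2 recursive2_pairn rf rs.
by move=> x; rewrite fE sE.
Qed.

(** The code of a nonempty list is a pair, hence positive, so testing against 0 separates the two
    cases. *)
Lemma computable_case_seq (s : X -> seq T) (f : X -> T -> seq T -> U) (g : X -> U) :
  computable s -> computable (fun p : X * T * seq T => f p.1.1 p.1.2 p.2) ->
  computable g -> computable (fun x => if s x is t :: r then f x t r else g x).
Proof.
move=> [s' rs sE] [f' rf fE] [g' rg gE].
exists (fun n => if s' n == 0 then g' n else
  f' (pairn (pairn n (fstn (s' n))) (sndn (s' n)))).
  apply: recursive1_if => //.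
  apply: (recursive1_app1 (op := f')) => //.
  apply: recursive1_app2 recursive2_pairn _ (recursive1_app1 recursive1_sndn rs).
  by apply: recursive1_app2 recursive2_pairn recursive1_id (recursive1_app1 recursive1_fstn rs).
move=> x; rewrite sE; case: (s x) => [|t r]; first by rewrite gE.
rewrite [encode (t :: r)]/(pairn (encode t) (encode r)) fstnE sndnE -(fE (x, t, r)).
by rewrite (gtn_eqF (leq_ltn_trans (leq0n _) (ltn_fst_pairn _ _))).
Qed.

End Basic.

Lemma leq_size_encode T `{coding T} (s : seq T) : size s <= encode s.
Proof.
by elim: s => //= t s IHs; apply: leq_ltn_trans IHs (ltn_snd_pairn _ _).
Qed.

Ltac computable_path := repeat lazymatch goal with
  | |- computable (fun x => x) => exact: computable_id
  | |- computable (fun x => fst _) => apply: computable_fst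
  | |- computable (fun x => snd _) => apply: computable_snd
  | |- computable fst => exact: (computable_fst computable_id)
  | |- computable snd => exact: (computable_snd computable_id)
  | |- computable (fun x => (_, _)) => apply: computable_pair
  | |- computable (fun x => _ :: _) => apply: computable_cons
  | |- computable (fun _ => ?c) => exact: computable_const
  end.

Section Lists.
Context {X T U V : Type} `{coding X} `{coding T} `{coding U} `{coding V}.

(** The fold is run as an iteration on pairs of an accumulator and a remaining list, stationary once
    the list is empty. The code of the list bounds its length and so provides enough rounds. *)
Lemma computable_foldl (f : X -> U -> T -> U) (z : X -> U) (s : X -> seq T) :
  computable (fun p : X * U * T => f p.1.1 p.1.2 p.2) -> computable z -> computable s ->
  computable (fun x => foldl (f x) (z x) (s x)).
Proof.
move=> cf cz cs.
pose step x (p : U * seq T) := if p.2 is t :: r then (f x p.1 t, r) else p.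
apply: (computable_ext (f := fun x => (iter (encode (s x)) (step x) (z x, s x)).1)).
  apply/computable_fst/computable_iter; first exact: computable_encode.
    apply: (computable_case_seq (s := fun p : X * (U * seq T) => p.2.2)
      (f := fun p t r => (f p.1 p.2.1 t, r))).
    - by computable_path.
    - apply: computable_pair; last by computable_path.
      apply: (computable_comp (f := fun p : X * U * T => f p.1.1 p.1.2 p.2)
        (g := fun p : X * (U * seq T) * T * seq T => (p.1.1.1, p.1.1.2.1, p.1.2))) => //.
      by computable_path.
    - by computable_path.
  exact: computable_pair.
move=> x; have: size (s x) <= encode (s x) by apply: leq_size_encode.
elim: (s x) (z x) (encode (s x)) => [|t r IHr] u k lek.
  suff -> : iter k (step x) (u, [::]) = (u, [::]) by [].
  by elim: k {lek} => //= k ->.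
by case: k lek => // k lek; rewrite iterSr /= (IHr _ k).
Qed.


End Lists.

Lemma computable_rev X T `{coding X} `{coding T} (s : X -> seq T) :
  computable s -> computable (fun x => rev (s x)).
Proof.
move=> cs.
apply: (computable_ext (f := fun x => foldl (fun r t => t :: r) [::] (s x))).
  by apply: (computable_foldl (f := fun _ r t => t :: r)) => //; computable_path.
by move=> x; rewrite /rev; elim: (s x) [::] => //= t r IHr a; rewrite IHr.
Qed.

Lemma computable_foldr X T U `{coding X} `{coding T} `{coding U}
    (f : X -> T -> U -> U) (z : X -> U) (s : X -> seq T) :
  computable (fun p : X * T * U => f p.1.1 p.1.2 p.2) -> computable z -> computable s ->
  computable (fun x => foldr (f x) (z x) (s x)).
Proof.
move=> cf cz cs.
apply: (computable_ext (f := fun x => foldl (fun u t => f x t u) (z x) (rev (s x)))).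
  apply: (computable_foldl (f := fun x u t => f x t u)) => //; last exact: computable_rev.
  apply: (computable_comp (f := fun p : X * T * U => f p.1.1 p.1.2 p.2)
    (g := fun p : X * U * T => (p.1.1, p.2, p.1.2))) => //.
  by computable_path.
by move=> x; rewrite foldl_rev.
Qed.

Section MoreLists.
Context {X T U : Type} `{coding X} `{coding T} `{coding U}.

Lemma computable_cat (r s : X -> seq T) :
  computable r -> computable s -> computable (fun x => r x ++ s x).
Proof.
move=> cr cs; apply: (computable_ext (f := fun x => foldr cons (s x) (r x))).
  by apply: (computable_foldr (f := fun _ => cons)) => //; computable_path.
by move=> x; elim: (r x) => //= t l ->.
Qed.

Lemma computable_map (f : X -> T -> U) (s : X -> seq T) :
  computable (fun p : X * T => f p.1 p.2) -> computable s ->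
  computable (fun x => map (f x) (s x)).
Proof.
move=> cf cs; apply: (computable_ext (f := fun x => foldr (fun t r => f x t :: r) [::] (s x))).
  apply: (computable_foldr (f := fun x t r => f x t :: r)) => //; computable_path.
  apply: (computable_comp (f := fun p : X * T => f p.1 p.2) (g := fun p : X * T * seq U => p.1)) => //.
  by computable_path.
by move=> x; elim: (s x) => //= t r ->.
Qed.

Lemma computable_filter (f : X -> T -> bool) (s : X -> seq T) :
  computable (fun p : X * T => f p.1 p.2) -> computable s ->
  computable (fun x => filter (f x) (s x)).
Proof.
move=> cf cs.
apply: (computable_ext (f := fun x => foldr (fun t r => if f x t then t :: r else r) [::] (s x))).
  apply: (computable_foldr (f := fun x t r => if f x t then t :: r else r)) => //; computable_path.
  apply: computable_if; computable_path.
  apply: (computable_comp (f := fun p : X * T => f p.1 p.2) (g := fun p : X * T * seq T => p.1)) => //.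
  by computable_path.
by [].
Qed.

Lemma computable_all (f : X -> T -> bool) (s : X -> seq T) :
  computable (fun p : X * T => f p.1 p.2) -> computable s ->
  computable (fun x => all (f x) (s x)).
Proof.
move=> cf cs.
apply: (computable_ext (f := fun x => foldr (fun t r => if f x t then r else false) true (s x))).
  apply: (computable_foldr (f := fun x t r => if f x t then r else false)) => //; computable_path.
  apply: computable_if; computable_path.
  apply: (computable_comp (f := fun p : X * T => f p.1 p.2) (g := fun p : X * T * bool => p.1)) => //.
  by computable_path.
by move=> x; elim: (s x) => //= t r ->; case: (f x t).
Qed.

Lemma computable_has (f : X -> T -> bool) (s : X -> seq T) :
  computable (fun p : X * T => f p.1 p.2) -> computable s ->
  computable (fun x => has (f x) (s x)).
Proof.
move=> cf cs.
apply: (computable_ext (f := fun x => if all (fun t => if f x t then false else true) (s x)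
  then false else true)).
  apply: computable_if; computable_path.
  by apply: (computable_all (f := fun x t => if f x t then false else true)) => //;
    apply: computable_if; computable_path.
by move=> x; elim: (s x) => //= t r ->; case: (f x t).
Qed.

End MoreLists.

Lemma computable_flatten X T `{coding X} `{coding T} (s : X -> seq (seq T)) :
  computable s -> computable (fun x => flatten (s x)).
Proof.
move=> cs; apply: (computable_foldr (f := fun _ => cat)) => //; first by apply: computable_cat; computable_path.
exact: computable_const.
Qed.

Lemma computable_succ X `{coding X} (k : X -> nat) :
  computable k -> computable (fun x => (k x).+1).
Proof.
case=> k' rk kE; exists (S \o k'); first exact: recursive1_app1 recursive1_succ rk.
by move=> x /=; rewrite kE.
Qed.

Lemma computable_addn X `{coding X} (j k : X -> nat) :
  computable j -> computable k -> computable (fun x => j x + k x).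
Proof. exact: computable_nat2 recursive2_addn. Qed.

Lemma computable_iota X `{coding X} (j k : X -> nat) :
  computable j -> computable k -> computable (fun x => iota (j x) (k x)).
Proof.
move=> cj ck.
apply: (computable_ext (f := fun x => rev (iter (k x) (fun r => (j x + size r) :: r) [::]))).
  apply/computable_rev/(computable_iter (f := fun x r => (j x + size r) :: r)) => //; computable_path.
  apply: computable_addn; first by apply: (computable_comp (f := j)) => //; computable_path.
  apply: (computable_ext (f := fun p : X * seq nat => foldr (fun _ => S) 0 p.2)).
    by apply: (computable_foldr (f := fun _ _ => S)); computable_path;
      apply: computable_succ; computable_path.
  by move=> p; elim: (p.2) => //= ? ? ->.
move=> x; suff [E _] : rev (iter (k x) (fun r => (j x + size r) :: r) [::]) = iota (j x) (k x) /\
   size (iter (k x) (fun r => (j x + size r) :: r) [::]) = k x by [].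
elim: (k x) => // n [IH1 IH2]; split; last by rewrite /= IH2.
by rewrite iterS IH2 rev_cons IH1 -cats1 -[n.+1]addn1 iotaD.
Qed.

Lemma computable_sumn X `{coding X} (s : X -> seq nat) :
  computable s -> computable (fun x => sumn (s x)).
Proof.
move=> cs; apply: (computable_foldr (f := fun _ => addn)) => //; last exact: computable_const.
by apply: computable_addn; computable_path.
Qed.

Lemma computable_andb X `{coding X} (a b : X -> bool) :
  computable a -> computable b -> computable (fun x => a x && b x).
Proof. by move=> ca cb; apply: computable_if => //; apply: computable_const. Qed.

Lemma encode_letter_inj n : injective (encode : letter n -> nat).
Proof.
move=> [i d] [j e]; rewrite /encode /coding_letter /= ![_.*2 + _]addnC => E.
have := congr1 half E; have := congr1 odd E.
rewrite !half_bit_double !oddD !odd_double !oddb !addbF => ->.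
by move=> /val_inj ->.
Qed.

(** The alphabet is finite, so any function on it, however obtained, is a lookup table. This is how
    the integer coefficients of the congruences enter a program. *)
Lemma computable_letter n U `{cU : coding U} (f : letter n -> U) : computable f.
Proof.
pose g c := oapp (fun l => cU (f l)) 0 [pick l : letter n | coding_letter l == c].
exists (nth 0 (mkseq g n.*2)); first exact: recursive1_table.
move=> l; rewrite nth_mkseq.
  rewrite /g; case: pickP => [k /eqP/encode_letter_inj -> //|/(_ l)].
  by rewrite eqxx.
case: l => i b; rewrite /encode /coding_letter /= -addnn -addnn.
case: b; case: i => i lti /=; rewrite ?addn0 ?addn1.
  by rewrite -addSn -addnS leq_add // ltnW.
by rewrite -addSn leq_add // ltnW.
Qed.

(** * Words and subgroups of finitely generated abelian groups *)

Local Open Scope group_scope.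

Definition invl n (l : letter n) : letter n := (l.1, ~~ l.2).
Definition invw n (w : word n) : word n := rev (map (@invl n) w).
Definition wpow n (w : word n) k : word n := iter k (cat w) [::].

Section Words.
Variables (G : groupType) (n : nat) (g : 'I_n -> G).
Implicit Types (u v w : word n) (l : letter n).

Definition leval l : G := if l.2 then (g l.1)^-1 else g l.1.

Lemma weval_cons l w : weval g (l :: w) = leval l * weval g w.
Proof. by []. Qed.

Lemma weval_cat u v : weval g (u ++ v) = weval g u * weval g v.
Proof. by elim: u => [|l u IHu]; rewrite ?mul1g // cat_cons !weval_cons IHu mulgA. Qed.

Lemma leval_inv l : leval (invl l) = (leval l)^-1.
Proof. by case: l => i [] //=; rewrite /leval /= invgK. Qed.

Lemma weval_inv w : weval g (invw w) = (weval g w)^-1.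
Proof.
elim: w => [|l w IHw]; first by rewrite invg1.
rewrite /invw map_cons rev_cons -cats1 weval_cat IHw !weval_cons leval_inv.
by rewrite mulg1 invgM.
Qed.

Lemma weval_pow w k : weval g (wpow w k) = weval g w ^+ k.
Proof. by elim: k => [|k IHk]; rewrite ?expg0 // /wpow iterS weval_cat IHk expgS. Qed.

Lemma weval_flatten (s : seq (word n)) : weval g (flatten s) = \prod_(w <- s) weval g w.
Proof. by elim: s => [|w s IHs]; rewrite ?big_nil // big_cons /= weval_cat IHs. Qed.

End Words.

(** * Subgroups of Z^n as solution sets of congruences *)

Section Congruences.
Local Open Scope ring_scope.
Import GRing.Theory Num.Theory intdiv.

(** A pair with second component 0 stands for a linear equation, since 0 divides only 0. *)
Definition congruent n (c : 'cV[int]_n * nat) (v : 'rV[int]_n) : bool :=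
  (c.2 %| (v *m c.1) 0%R 0%R)%Z.

(* The subgroup is cut out by its projection dZ to the first coordinate and by
   its intersection with the kernel of that projection: if [row_mx d u] is in
   [K] and d divides x, then [row_mx x v] is in [K] iff [v - (x / d) u] is in
   the intersection, and multiplying the congruences of the latter by d clears
   the denominator. *)
Lemma subgroup_congruences n (K : 'rV[int]_n -> Prop) :
  K 0 -> (forall u v, K u -> K v -> K (u - v)) ->
  exists s, forall v, K v <-> all (@congruent _ ^~ v) s.
Proof.
elim: n K => [|n IHn] K K0 KB.
  by exists [::] => v; rewrite (thinmx0 v).
have KN u : K u -> K (- u) by move=> Ku; rewrite -sub0r; apply: KB.
have KD u v : K u -> K v -> K (u + v).
  by move=> Ku Kv; rewrite -(opprK v); apply: KB => //; apply: KN.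
have KMn u k : K u -> K (u *+ k).
  by move=> Ku; elim: k => [|k IHk]; rewrite ?mulr0n // mulrS; apply: KD.
have KZ (q : int) u : K u -> K (q *: u).
  move=> Ku; case: q => k; first by rewrite -natz scaler_nat; apply: KMn.
  by rewrite NegzE scaleNr -natz scaler_nat; apply/KN/KMn.
pose emb (x : int) (v : 'rV[int]_n) : 'rV[int]_(1 + n) := row_mx x%:M v.
have embE (v : 'rV[int]_n.+1) : v = emb (v 0 0) (rsubmx (v : 'rV[int]_(1 + n))).
  have -> : v 0 0 = lsubmx (v : 'rV[int]_(1 + n)) 0 0.
    by rewrite mxE; congr (v _ _); apply: val_inj.
  by rewrite /emb -mx11_scalar hsubmxK.
have embB x y u v : emb x u - emb y v = emb (x - y) (u - v).
  by rewrite /emb opp_row_mx add_row_mx raddfB.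
have embZ q x u : q *: emb x u = emb (q * x) (q *: u).
  by rewrite /emb scale_row_mx scale_scalar_mx.
have emb_mul x v y (a : 'cV[int]_n) :
    (emb x v *m (col_mx y%:M a : 'cV[int]_(1 + n))) 0 0 = x * y + (v *m a) 0 0.
  by rewrite mul_row_col !mxE big_ord1 !mxE !mulr1n.
have [s sE] : exists s, forall v, K (emb 0 v) <-> all (@congruent _ ^~ v) s.
  apply: IHn => [|u v Ku Kv]; first by rewrite /emb raddf0 row_mx0.
  by rewrite -(subrr 0) -embB; apply: KB.
have [[d [d_gt0 [u Ku] dmin]]|K_0] : 
    (exists d : nat, [/\ (0 < d)%N, exists u, K (emb d u) &
        forall x v, K (emb x v) -> (d %| x)%Z])
     \/ forall x v, K (emb x v) -> x = 0.
  have [[x [x0 [v Kv]]]|noK] :=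
    pselect (exists x : int, x != 0 /\ exists v, K (emb x v)); last first.
    right=> x v Kv; apply/eqP/negPn/negP => x0; apply: noK; exists x; split=> //.
    by exists v.
  (* [d] is the least positive first coordinate in [K]; [K] being an arbitrary predicate, it is
     found classically. Division with remainder then shows that it divides every other first
     coordinate. *)
  left; pose P (d : nat) := `[< (0 < d)%N /\ exists v, K (emb d v) >].
  have exP : exists d, P d.
    exists `|x|%N; apply/asboolP; split; first by rewrite absz_gt0.
    have [x_ge0|x_lt0] := lerP 0 x; first by exists v; rewrite gez0_abs.
    exists (- v); rewrite ltz0_abs // -[- x]sub0r -[- v]sub0r -embB.
    by apply: KB => //; rewrite /emb raddf0 row_mx0.
  have [d /asboolP[d_gt0 [u Ku]] dmin] := ex_minnP exP.
  exists d; split=> //; first by exists u.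
  move=> y w Kw; apply/dvdz_mod0P/eqP; rewrite -[_ == _]negbK; apply/negP => r0.
  have r_ge0 : (0 <= y %% d)%Z by rewrite modz_ge0 // eqz_nat -lt0n.
  have : P `|(y %% d)%Z|%N.
    apply/asboolP; split; first by rewrite absz_gt0.
    exists (w - (y %/ d)%Z *: u); rewrite gez0_abs // /modz -embB -embZ.
    by apply: KB => //; apply: KZ.
  move=> /dmin; rewrite leqNgt => /negP[].
  by rewrite -ltz_nat gez0_abs // ltz_pmod // ltz_nat.
(* With x = q d, the product of d and a . (v - q u) is d (a . v) - x (a . u), a form with integer
   coefficients in x and v; the modulus is multiplied by d as well. *)
- pose lift (c : 'cV[int]_n * nat) : 'cV[int]_(1 + n) * nat :=
    (col_mx (- (u *m c.1) 0 0)%:M (d%:Z *: c.1), (d * c.2)%N).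
  have liftE (q : int) v c : congruent (lift c) (emb (q * d%:Z) v) = congruent c (v - q *: u).
    rewrite /congruent emb_mul /= PoszM mulmxBl -scalemxAl -scalemxAr.
    have d_neq0 : d%:Z != 0 by rewrite eqz_nat -lt0n.
    rewrite -[RHS](dvdz_mul2l d_neq0); congr (_ \in dvdz _).
    move: (v *m _) (u *m _) => a b; rewrite !mxE; ring.
  (* The additional congruence says that d divides the first coordinate. *)
  exists ((col_mx 1%:M 0, d) :: map lift s) => v; rewrite (embE v) /=.
  rewrite {1}/congruent emb_mul mulr1 mulmx0 mxE addr0 all_map.
  set x := v 0 0; set v' := rsubmx _.
  have key (q : int) : x = q * d%:Z ->
      K (emb x v') <-> all (preim lift (@congruent _ ^~ (emb x v'))) s.
    move=> ->; rewrite (eq_all (liftE q v')) -sE.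
    have -> : emb 0 (v' - q *: u) = emb (q * d%:Z) v' - q *: emb d u.
      by rewrite embZ embB subrr.
    split=> [Kx|Kx]; first by apply: KB => //; apply: KZ.
    by rewrite -[emb _ v'](subrK (q *: emb d u)); apply: KD => //; apply: KZ.
  split=> [Kx|/andP[/dvdzP[q xE]]]; last by move/(key q xE).
  by have dx := dmin _ _ Kx; rewrite dx /=; have /dvdzP[q /key xE] := dx; apply/xE.
(* The first coordinate vanishes on all of [K]; the modulus 0 expresses this. *)
- exists ((col_mx 1%:M 0, 0%N) :: [seq (col_mx 0 c.1, c.2) | c <- s]) => v.
  rewrite (embE v) /= {1}/congruent emb_mul mulr1 mulmx0 mxE addr0 dvd0z.
  set x := v 0 0; set v' := rsubmx _.
  have allE : all (@congruent _ ^~ (emb x v')) [seq (col_mx 0 c.1, c.2) | c <- s] =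
      all (@congruent _ ^~ v') s.
    rewrite all_map; apply: eq_all => c; rewrite /= /congruent /=.
    have -> : (0 : 'M[int]_(1, 1)) = (0 : int)%:M by rewrite raddf0.
    by rewrite emb_mul mulr0 add0r.
  rewrite allE; split=> [Kx|/andP[/eqP x0]]; last by rewrite x0 -sE.
  by have x0 := K_0 _ _ Kx; rewrite x0 eqxx -sE -x0.
Qed.

End Congruences.

(** * Exponent vectors of words *)

Section Exponents.
Local Open Scope ring_scope.
Import GRing.Theory Num.Theory intdiv.
Variable n : nat.
Implicit Types (w : word n) (l : letter n) (a : 'cV[int]_n).

Definition expvec w : 'rV[int]_n :=
  \row_i ((count_mem (i, false) w)%:Z - (count_mem (i, true) w)%:Z).

Lemma expvec_cat u w : expvec (u ++ w) = expvec u + expvec w.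
Proof. by apply/rowP => i; rewrite !mxE !count_cat; lia. Qed.

Lemma expvec_inv w : expvec (invw w) = - expvec w.
Proof.
apply/rowP => i; rewrite !mxE !count_rev !count_map.
have E b : count (preim (@invl n) (pred1 (i, b))) w = count_mem (i, ~~ b) w.
  by apply: eq_count => -[j c]; rewrite /= /invl !xpair_eqE /=; case: b; case: c.
by rewrite !E /=; lia.
Qed.

Lemma expvec_pow w k : expvec (wpow w k) = expvec w *+ k.
Proof.
elim: k => [|k IHk]; first by rewrite mulr0n; apply/rowP => i; rewrite !mxE.
by rewrite /wpow iterS expvec_cat IHk mulrS.
Qed.

Definition weight a l : int := if l.2 then - a l.1 0 else a l.1 0.
(** Recursive functions act on natural numbers, so an integer dot product is carried as a difference
    of two sums of naturals. *)
Definition posw a l : nat := if 0 <= weight a l then `|weight a l|%N else 0%N.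
Definition negw a l : nat := if 0 <= weight a l then 0%N else `|weight a l|%N.

Lemma dot_expvec a w : (expvec w *m a) 0 0 =
  (sumn (map (posw a) w))%:Z - (sumn (map (negw a) w))%:Z.
Proof.
elim: w => [|[i b] w IHw].
  have -> : expvec [::] = 0 by apply/rowP => i; rewrite !mxE.
  by rewrite mul0mx mxE.
rewrite -cat1s expvec_cat mulmxDl mxE IHw.
have -> : (expvec [:: (i, b)] *m a) 0 0 = weight a (i, b).
  rewrite mxE (bigD1 i) //= big1 => [|j ji]; rewrite !mxE /= ?xpair_eqE ?eqxx.
    by rewrite addr0 /weight; case: b => /=; lia.
  by rewrite eq_sym (negPf ji) subrr mul0r.
rewrite /= /posw /negw; case: (lerP 0 (weight a (i, b))) => h; lia.
Qed.

End Exponents.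

(** * Deciding membership in a subgroup of an abelian group *)

Section AbelianWords.
Variables (G : groupType) (n : nat) (g : 'I_n -> G).
Hypothesis mulgC : forall x y : G, x * y = y * x.
Implicit Types (u v w : word n).

(** A nonempty word with zero exponents contains the inverse of its first letter. By commutativity
    the two cancel, and the shorter word still has zero exponents. *)
Lemma weval_expvec0 w : expvec w = 0%R -> weval g w = 1.
Proof.
elim: {w}_.+1 {-2}w (ltnSn (size w)) => // k IHk [|l w] //=.
rewrite ltnS => ltw w0.
have lw : invl l \in w.
  apply/negPn/negP => /count_memPn lw.
  have := congr1 (fun v : 'rV[int]_n => v ord0 l.1) w0; rewrite !mxE /=.
  move: lw; case: l {w0} => i [] /= ->; rewrite !xpair_eqE !eqxx /=; lia.
case/path.splitPr: lw ltw w0 => w1 w2 ltw w0.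
transitivity (weval g (w1 ++ w2)).
  rewrite -/(leval g l) !weval_cat weval_cons leval_inv [_^-1 * _]mulgC.
  by rewrite [LHS]mulgC -!mulgA mulVg mulg1.
apply: IHk; first by move: ltw; rewrite !size_cat /=; lia.
rewrite -w0 -cat1s -[invl l :: w2]cat1s !expvec_cat.
have -> : [:: invl l] = invw [:: l] by [].
by rewrite expvec_inv GRing.addrCA GRing.addNKr.
Qed.

Lemma weval_expvec u v : expvec u = expvec v -> weval g u = weval g v.
Proof.
move=> uv; apply: divg1_eq; rewrite -weval_inv -weval_cat; apply: weval_expvec0.
by rewrite expvec_cat expvec_inv uv GRing.subrr.
Qed.

(** The congruences defining the preimage of [K] in Z^n are of two kinds: those with nonzero
    modulus, which every M-th power satisfies, and equations. Since Z has no torsion, a word with a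
    positive power in [K] satisfies the equations, hence its M-th power is in [K]. Along the powers
    of a word that violates an equation, the left side of that equation grows linearly, which bounds
    [k]. *)
Lemma subgroup_decidable (K : G -> Prop) :
  K 1 -> (forall x y, K x -> K y -> K (x * y^-1)) ->
  exists (mem : word n -> bool) (bound : word n -> nat) (M : nat),
  0 < M /\
  [/\ computable (T := seq (letter n)) mem,
      computable (T := seq (letter n)) bound,
      forall w, mem w <-> K (weval g w),
      forall w k, 0 < k -> K (weval g w ^+ k) -> K (weval g w ^+ M) &
      forall u w k, ~ K (weval g w ^+ M) ->
        K (weval g u * weval g w ^+ k) -> k <= bound u].
Proof.
move=> K1 KB.
(* In an abelian group the value of a word depends only on its exponents, so [K] can be pulled back
   to Z^n. *)
pose KZ (v : 'rV[int]_n) := exists2 w : word n, expvec w = v & K (weval g w).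
have KZE w : KZ (expvec w) <-> K (weval g w).
  by split=> [[u /weval_expvec -> //]|Kw]; exists w.
have [||s sE] := @subgroup_congruences n KZ.
- by exists [::] => //; apply/rowP => i; rewrite !mxE.
- move=> _ _ [u <- Ku] [v <- Kv]; exists (u ++ invw v); last by rewrite weval_cat weval_inv; apply: KB.
  by rewrite expvec_cat expvec_inv.
pose pos (c : 'cV[int]_n * nat) w := sumn (map (posw c.1) w).
pose neg (c : 'cV[int]_n * nat) w := sumn (map (negw c.1) w).
have cpos c : computable (T := seq (letter n)) (pos c).
  apply/computable_sumn/(computable_map (f := fun _ => posw c.1)); last exact: computable_id.
  by apply: (computable_comp (f := posw c.1)) (computable_letter _) _; computable_path.
have cneg c : computable (T := seq (letter n)) (neg c).
  apply/computable_sumn/(computable_map (f := fun _ => negw c.1)); last exact: computable_id.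
  by apply: (computable_comp (f := negw c.1)) (computable_letter _) _; computable_path.
exists (fun w => all (fun c => pos c w == neg c w %[mod c.2]) s).
exists (fun w => sumn [seq pos c w + neg c w | c <- s]).
(* [M] is a positive common multiple of all nonzero moduli. *)
exists (\prod_(c <- s | c.2 != 0) c.2)%N.
have memE w : K (weval g w) <-> all (@congruent _ ^~ (expvec w)) s.
  by rewrite -sE KZE.
have congr_pow c w k : congruent c (expvec (wpow w k)) =
    (c.2 %| ((expvec w *m c.1) ord0 ord0 *+ k)%R)%Z.
  by rewrite /congruent expvec_pow -GRing.scaler_nat -scalemxAl mxE GRing.mulr_natl.
have dvdM c w : c \in s -> c.2 != 0 ->
    congruent c (expvec (wpow w (\prod_(c <- s | c.2 != 0%N) c.2)%N)).
  move=> cs c0; rewrite congr_pow -GRing.mulr_natr natz intdiv.dvdz_mull //.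
  by rewrite (big_rem c) //= c0 PoszM intdiv.dvdz_mulr.
split; first by apply: prodn_cond_gt0 => c; rewrite lt0n.
split.
- elim: s {sE memE dvdM} => [|c s IHs] /=; first exact: computable_const.
  apply: computable_andb => //; apply: computable_eqn.
    exact: computable_nat2 recursive2_modn _ (computable_const _).
  exact: computable_nat2 recursive2_modn _ (computable_const _).
- elim: s {sE memE dvdM} => [|c s IHs] /=; first exact: computable_const.
  by apply: computable_addn => //; apply: computable_addn.
- move=> w; rewrite memE; suff -> : all (fun c => pos c w == neg c w %[mod c.2]) s =
    all (@congruent _ ^~ (expvec w)) s by [].
  by apply: eq_all => c; rewrite /congruent dot_expvec -intdiv.eqz_mod_dvd !intdiv.modz_nat eqz_nat.
- move=> w k k_gt0; rewrite -!weval_pow !memE => /allP sk; apply/allP => c cs.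
  have [c0|c0] := eqVneq c.2 0; last exact: dvdM.
  move: (sk c cs); rewrite !congr_pow c0 !intdiv.dvd0z.
  by rewrite Num.Theory.mulrn_eq0 eqn0Ngt k_gt0 /= => /eqP ->; rewrite GRing.mul0rn.
- move=> u w k; rewrite -!weval_pow -weval_cat !memE => /negP/allPn[c cs ncM] /allP/(_ c cs).
  (* The congruences with nonzero modulus hold at the M-th power, so the violated one is an
     equation. *)
  have c0 : c.2 = 0 by apply/eqP/negPn/negP => c0; move: ncM; rewrite dvdM.
  move: ncM; rewrite congr_pow c0 intdiv.dvd0z => ncM.
  have dotE : ((expvec (u ++ wpow w k) *m c.1) ord0 ord0 =
      (expvec u *m c.1) ord0 ord0 + (expvec w *m c.1) ord0 ord0 *+ k)%R.
    by rewrite expvec_cat expvec_pow mulmxDl mxE -GRing.scaler_nat -scalemxAl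
      [in X in (_ + X)%R]mxE GRing.mulr_natl.
  rewrite /congruent c0 intdiv.dvd0z dotE => /eqP uw0.
  apply: (@leq_trans (pos c u + neg c u)); last first.
    by rewrite sumnE big_map (big_rem c) //= leq_addr.
  move: ncM uw0; rewrite Num.Theory.mulrn_eq0 negb_or => /andP[_].
  rewrite (dot_expvec _ u) -/(pos c u) -/(neg c u) -GRing.mulr_natr natz.
  move: ((expvec w *m c.1)%R ord0 ord0) (pos c u) (neg c u) => d P N d0.
  (* A nonzero integer d has absolute value at least 1, so k is at most |d k| = |P - N|, which is at
     most P + N. *)
  move=> uw0; have [h|h] : (d <= -1 \/ 1 <= d)%R by lia.
    have : (0 <= (-1 - d) * k%:Z)%R by rewrite Num.Theory.mulr_ge0 //; lia.
    by lia.
  have : (0 <= (d - 1) * k%:Z)%R by rewrite Num.Theory.mulr_ge0 //; lia.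
  by lia.
Qed.

End AbelianWords.

(** * Twisted conjugacy along the orbits of a bijection *)

Section Orbits.
Variables (S : choiceType) (A : groupType) (tau tau' : S -> S).
Hypotheses (tauK : cancel tau tau') (tauK' : cancel tau' tau).
Implicit Types (f g h : fsupp_fun S A) (p q s t : S) (ps : seq S).

Definition intertwines f g h s : Prop := f (tau s) * h (tau s) = h s * g (tau s).

Definition cohomologous f g : Prop := exists h, forall s, intertwines f g h s.

(** The product starts at [tau q] rather than [q] because the equation at [s] involves [f] and [g]
    at [tau s]. *)
Definition orbprod f q L : A := \prod_(j <- iota 1 L) f (iter j tau q).

Definition same_orbit p s : Prop := exists k, s = iter k tau p \/ p = iter k tau s.

Lemma iter_tau_inj k : injective (iter k tau).
Proof. by elim: k => //= k IHk p q /(can_inj tauK)/IHk. Qed.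

Lemma iter_tauK k q : iter k tau (iter k tau' q) = q.
Proof. by elim: k q => //= k IHk q; rewrite -iterS iterSr tauK'. Qed.

Lemma iter_tauB i j p q : i <= j -> iter i tau p = iter j tau q -> p = iter (j - i) tau q.
Proof. by move=> leij; rewrite -{1}(subnKC leij) iterD => /iter_tau_inj. Qed.

Lemma same_orbit_refl p : same_orbit p p.
Proof. by exists 0; left. Qed.

Lemma same_orbit_iter k p s : same_orbit (iter k tau p) s <-> same_orbit p s.
Proof.
split=> -[i [E|E]].
- by exists (i + k); left; rewrite E iterD.
- case: (leqP k i) => [le|/ltnW le].
    by exists (i - k); right; apply: iter_tauB E.
  by exists (k - i); left; apply: iter_tauB.
- case: (leqP k i) => [le|/ltnW le].
    by exists (i - k); left; rewrite E -{1}(subnK le) iterD.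
  by exists (k - i); right; rewrite E -{1}(subnK le) iterD.
- by exists (k + i); right; rewrite E iterD.
Qed.

Lemma same_orbit_tau p s : same_orbit p (tau s) <-> same_orbit p s.
Proof.
have sym p' s' : same_orbit p' s' -> same_orbit s' p'.
  by case=> k [E|E]; exists k; [right|left].
split=> /sym; first by move/(same_orbit_iter 1)/sym.
by move=> /(same_orbit_iter 1 s)/sym.
Qed.

Lemma orbprodS f q L : orbprod f q L.+1 = orbprod f q L * f (iter L.+1 tau q).
Proof. by rewrite /orbprod -[L.+1]addn1 iotaD big_cat big_seq1 add1n addn1. Qed.

Lemma orbprod0 f q : orbprod f q 0 = 1.
Proof. exact: big_nil. Qed.

(** The equations at consecutive points telescope. *)
Lemma intertwines_orbprod f g h q L : (forall s, intertwines f g h s) ->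
  orbprod f q L * h (iter L tau q) = h q * orbprod g q L.
Proof.
move=> fgh; elim: L => [|L IHL]; first by rewrite !orbprod0 mul1g mulg1.
by rewrite !orbprodS -mulgA [f _ * h _]fgh !mulgA IHL.
Qed.

(** An equation links only [s] and [tau s] and so stays inside one orbit; local solutions can
    therefore be patched. Where several points of [ps] share an orbit, the solution attached to the
    first of them is kept. *)
Lemma glue_orbits f g ps :
  (forall p, p \in ps -> exists h, (forall s, same_orbit p s -> intertwines f g h s) /\
     (forall s, ~ same_orbit p s -> h s = 1)) ->
  exists h, (forall s, (exists2 p, p \in ps & same_orbit p s) -> intertwines f g h s) /\
     (forall s, (forall p, p \in ps -> ~ same_orbit p s) -> h s = 1).
Proof.
elim: ps => [|p ps IHps] loc.
  by exists [fsfun]; split=> [s []|s _]; rewrite ?fsfun0E.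
have [|h [hint h1]] := IHps; first by move=> q qps; apply: loc; rewrite inE qps orbT.
have [|hp [hpint hp1]] := loc p; first by rewrite mem_head.
pose k : fsupp_fun S A :=
  [fsfun s in (finsupp hp `|` finsupp h)%fset => if `[< same_orbit p s >] then hp s else h s | 1].
have kE s : k s = if `[< same_orbit p s >] then hp s else h s.
  rewrite fsfunE inE; case: ifPn => // /norP[nhp nh].
  by rewrite !fsfun_dflt //; case: ifP.
exists k; split=> s; last first.
  move=> out; rewrite kE asboolF; first by apply: h1 => q qps; apply: out; rewrite inE qps orbT.
  by apply: out; rewrite mem_head.
rewrite /intertwines !kE (asbool_equiv_eq (same_orbit_tau p s)).
case: asboolP => [ps_s _|nps_s]; first exact: hpint.
case=> q; rewrite inE => /predU1P[-> //|qps qs]; apply: hint.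
by exists q.
Qed.

Lemma glue_cohomologous f g ps :
  (forall s, s \notin ps -> f s = 1 /\ g s = 1) ->
  (forall p, p \in ps -> exists h, (forall s, same_orbit p s -> intertwines f g h s) /\
     (forall s, ~ same_orbit p s -> h s = 1)) ->
  cohomologous f g.
Proof.
move=> supp /glue_orbits[h [hint h1]]; exists h => s.
have [|no] := pselect (exists2 p, p \in ps & same_orbit p s); first exact: hint.
have out t : same_orbit s t -> h t = 1 /\ (f t = 1 /\ g t = 1).
  case=> k kst; have nt p : p \in ps -> ~ same_orbit p t.
    move=> pps pt; apply: no; exists p => //.
    case: kst pt => ->; first by elim: k => //= k IHk /same_orbit_tau.
    by elim: k => //= k IHk /IHk/same_orbit_tau.
  split; first exact: h1.
  by apply: supp; apply/negP => /nt; apply; apply: same_orbit_refl.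
have [] := out s (same_orbit_refl s).
have [] := out (tau s); first exact/same_orbit_tau/same_orbit_refl.
by rewrite /intertwines => -> [-> ->] ->.
Qed.

(** The solution with value [z] at [q], its further values being dictated by telescoping, cut off to
    1 outside the [L] points starting at [q]. *)
Definition window f g z q L : fsupp_fun S A :=
  let w := mkseq (fun j => iter j tau q) L in
  [fsfun s in [fset t | t in w]%fset =>
     (orbprod f q (index s w))^-1 * z * orbprod g q (index s w) | 1].

Lemma window_out f g z q L s :
  (forall j, j < L -> s <> iter j tau q) -> window f g z q L s = 1.
Proof.
move=> out; rewrite fsfunE; case: ifP => // /imfsetP[t /= /mapP[j]].
by rewrite mem_iota => /andP[_ jL] -> /out.
Qed.

Lemma window_in f g z q L j :
  {in gtn L &, injective (fun j => iter j tau q)} -> j < L ->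
  window f g z q L (iter j tau q) = (orbprod f q j)^-1 * z * orbprod g q j.
Proof.
move=> /mkseq_uniqP uq jL; rewrite fsfunE.
have jw : iter j tau q \in mkseq (fun j => iter j tau q) L.
  by apply/mapP; exists j; rewrite ?mem_iota.
case: imfsetP => [_|[]]; last by exists (iter j tau q).
rewrite -[iter j tau q](nth_mkseq q (fun j => iter j tau q) jL).
by rewrite index_uniq ?size_mkseq.
Qed.

Lemma window_step f g z q j :
  f (iter j.+1 tau q) * ((orbprod f q j.+1)^-1 * z * orbprod g q j.+1) =
  (orbprod f q j)^-1 * z * orbprod g q j * g (iter j.+1 tau q).
Proof. by rewrite !orbprodS invgM !mulgA mulgV mul1g. Qed.

Lemma iter_inj_in q L : (forall k, 0 < k < L -> iter k tau q <> q) ->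
  {in gtn L &, injective (fun j => iter j tau q)}.
Proof.
move=> noper; have wlg i j : i <= j -> j < L -> iter i tau q = iter j tau q -> i = j.
  move=> leij jL /(iter_tauB leij) E; apply/eqP; rewrite eqn_leq leij /= leqNgt.
  by apply/negP => ltij; case: (noper (j - i)) => //; rewrite subn_gt0 ltij; lia.
move=> i j; rewrite !inE => iL jL E; case: (leqP i j) => [le|/ltnW le]; first exact: wlg.
by apply/esym/wlg.
Qed.

Lemma periodic_same_orbit q N s : 0 < N -> iter N tau q = q -> same_orbit q s ->
  exists2 j, j < N & s = iter j tau q.
Proof.
move=> N_gt0 per.
have perM k : iter (k * N) tau q = q by elim: k => // k IHk; rewrite mulSn iterD IHk.
have pos k : exists2 j, j < N & iter k tau q = iter j tau q.
  exists (k %% N); first by rewrite ltn_mod.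
  by rewrite {1}(divn_eq k N) addnC iterD perM.
case=> k [->|E]; first exact: pos.
(* On a cycle of length N, k steps back are k * N - k steps forward. *)
have [j jN jE] := pos (k * N - k).
exists j => //; apply: (iter_tau_inj (k := k)); rewrite -jE -iterD subnKC ?perM //.
by rewrite leq_pmulr.
Qed.

Lemma periodic_solution f g z q N : 0 < N -> iter N tau q = q ->
  (forall k, 0 < k < N -> iter k tau q <> q) ->
  orbprod f q N * z = z * orbprod g q N ->
  exists h, (forall s, same_orbit q s -> intertwines f g h s) /\
     (forall s, ~ same_orbit q s -> h s = 1).
Proof.
move=> N_gt0 per /iter_inj_in inj fzg; exists (window f g z q N); split=> s; last first.
  by move=> out; apply: window_out => j _ E; apply: out; exists j; left.
move=> /(periodic_same_orbit N_gt0 per)[j jN ->]; rewrite /intertwines -iterS.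
rewrite (window_in _ _ _ inj jN) -window_step; congr (_ * _).
case: (ltnP j.+1 N) => [ltjN|geN]; first by rewrite window_in.
have -> : j.+1 = N by apply/eqP; rewrite eqn_leq jN.
(* Closing the cycle: the value dictated at the N-th point, which is [q] again, has to be [z]. This
   is the assumption on [z]. *)
rewrite per -[q in LHS]/(iter 0 tau q) window_in // !orbprod0 invg1 mul1g mulg1.
by rewrite -mulgA -fzg mulKg.
Qed.

Lemma aperiodic_solution f g q L : (forall k, 0 < k -> iter k tau q <> q) ->
  (forall s, same_orbit q s -> (forall j, 0 < j <= L -> s <> iter j tau q) -> f s = 1 /\ g s = 1) ->
  orbprod f q L = orbprod g q L ->
  exists h, (forall s, same_orbit q s -> intertwines f g h s) /\
     (forall s, ~ same_orbit q s -> h s = 1).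
Proof.
move=> noper supp fg.
have inj : {in gtn L &, injective (fun j => iter j tau q)}.
  by apply: iter_inj_in => k /andP[/noper].
exists (window f g 1 q L); split=> s; last first.
  by move=> out; apply: window_out => j _ E; apply: out; exists j; left.
move=> qs; rewrite /intertwines.
have [[j jL ->]|out] := pselect (exists2 j, j < L & s = iter j tau q).
  rewrite -iterS (window_in _ _ _ inj jL) -window_step; congr (_ * _).
  case: (ltnP j.+1 L) => [ltjN|geL]; first by rewrite window_in.
  have -> : j.+1 = L by apply/eqP; rewrite eqn_leq jL.
  (* Leaving the window: the value dictated at the [L]-th point is 1 because the two products
     agree. *)
  rewrite fg mulg1 mulVg window_out // => i iL E.
  by apply: (noper (L - i)); [rewrite subn_gt0 | rewrite -(@iter_tauB i L q q) // ltnW].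
rewrite [window _ _ _ _ _ s]window_out; last by move=> j jL E; apply: out; exists j.
have [-> ->] : f (tau s) = 1 /\ g (tau s) = 1.
  apply: supp; first exact/same_orbit_tau.
  by move=> [|j] //= jL /(can_inj tauK) E; apply: out; exists j.
(* Outside the window the only delicate equation is the one at the point just before [q]; it holds
   because the window starts with the value 1. *)
rewrite !mul1g; have [E|nE] := pselect (tau s = q /\ 0 < L).
  case: E => -> L_gt0; rewrite -[q in LHS]/(iter 0 tau q) window_in //.
  by rewrite !orbprod0 invg1 !mulg1.
rewrite window_out // => -[|j] jL E; first by apply: nE.
by apply: out; exists j; [exact: ltnW | apply: (can_inj tauK)].
Qed.

Lemma injective_escapes (u : nat -> S) (X : {fset S}) : injective u -> exists k, u k \notin X.
Proof.
move=> inju; apply: contrapT => /forallNP all_in.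
have : size (mkseq u #|` X|.+1) <= #|` X|.
  apply: uniq_leq_size; first by apply/mkseq_uniqP => i j _ _ /inju.
  move=> _ /mapP[j _ ->]; apply/negPn/negP; exact: all_in.
by rewrite size_mkseq ltnn.
Qed.

(** Beyond the given stretch, on either side, [f] and [g] are trivial, so [h] is constant there. The
    orbit being infinite and the support of [h] finite, both constants are 1, and the telescoped
    equation becomes an equality of products. *)
Lemma aperiodic_orbprod f g q L : (forall k, 0 < k -> iter k tau q <> q) ->
  (forall s, same_orbit q s -> (forall j, 0 < j <= L -> s <> iter j tau q) -> f s = 1 /\ g s = 1) ->
  cohomologous f g -> orbprod f q L = orbprod g q L.
Proof.
move=> noper supp [h fgh].
have inj i j : iter i tau q = iter j tau q -> i = j.
  by apply: (@iter_inj_in q (maxn i j).+1) => [k /andP[/noper]||]; rewrite // inE ltnS leq_max leqnn ?orbT.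
have hL : h (iter L tau q) = 1.
  have [|k kX] := @injective_escapes (fun k => iter (k + L) tau q) (finsupp h).
    by move=> i j /inj /addIn.
  rewrite -[RHS](fsfun_dflt kX); elim: k {kX} => // k ->.
  have [||f1 g1] := supp (iter (k + L).+1 tau q).
  - by exists (k + L).+1; left.
  - by move=> j /andP[_ jL] /inj; lia.
  have := fgh (iter (k + L) tau q); by rewrite /intertwines -iterS f1 g1 mul1g mulg1.
have h0 : h q = 1.
  have [|k kX] := @injective_escapes (fun k => iter k tau' q) (finsupp h).
    move=> i j /= /(congr1 (iter (i + j) tau)); rewrite {1}addnC !iterD !iter_tauK.
    by move/inj.
  rewrite -[RHS](fsfun_dflt kX); elim: k {kX} => // k ->.
  have [||f1 g1] := supp (iter k tau' q).
  - by exists k; right; rewrite iter_tauK.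
  - move=> j /andP[j0 _] /(congr1 (iter k tau)); rewrite iter_tauK -iterD => /esym.
    by apply: noper; lia.
  have := fgh (iter k.+1 tau' q); by rewrite /intertwines /= tauK' f1 g1 mul1g mulg1.
by have := intertwines_orbprod q L fgh; rewrite hL h0 mul1g mulg1.
Qed.

Lemma cohomologous_periodic f g ps N : 0 < N -> (forall q, iter N tau q = q) ->
  (forall q k, 0 < k < N -> iter k tau q <> q) ->
  (forall s, s \notin ps -> f s = 1 /\ g s = 1) ->
  cohomologous f g <->
  forall p, p \in ps -> exists z, orbprod f p N * z = z * orbprod g p N.
Proof.
move=> N_gt0 per noper supp; split=> [[h fgh] p _|sol].
  by exists (h p); rewrite -(intertwines_orbprod p N fgh) per.
apply: (glue_cohomologous supp) => p /sol[z fzg].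
exact: periodic_solution (per p) (noper p) fzg.
Qed.

(** Starting [R] steps before [p] makes the stretch of length [R + R] reach every point of [ps] on
    the orbit of [p], whichever side of [p] it lies on. *)
Lemma cohomologous_aperiodic f g ps R : (forall q k, 0 < k -> iter k tau q <> q) ->
  (forall p q k, p \in ps -> q \in ps -> q = iter k tau p -> k < R) ->
  (forall s, s \notin ps -> f s = 1 /\ g s = 1) ->
  cohomologous f g <->
  forall p, p \in ps ->
    orbprod f (iter R tau' p) (R + R) = orbprod g (iter R tau' p) (R + R).
Proof.
move=> noper bound supp.
have far p : p \in ps -> forall s, same_orbit (iter R tau' p) s ->
    (forall j, 0 < j <= R + R -> s <> iter j tau (iter R tau' p)) -> f s = 1 /\ g s = 1.
  move=> pps s ps_s out; apply: supp; apply/negP => sps.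
  have pE := iter_tauK R p.
  have [k [E|E]] : same_orbit p s by rewrite -pE; apply/same_orbit_iter.
    have kR := bound _ _ _ pps sps E.
    by apply: (out (k + R)); [lia | rewrite iterD pE].
  have kR := bound _ _ _ sps pps E.
  apply: (out (R - k)); first by lia.
  by apply: (iter_tauB (ltnW kR)); rewrite pE.
split=> [fg p pps|sol]; first by apply: aperiodic_orbprod (far p pps) fg; apply: noper.
apply: (glue_cohomologous supp) => p pps.
have [h [hint h1]] := aperiodic_solution (noper _) (far p pps) (sol p pps).
have oE s : same_orbit p s <-> same_orbit (iter R tau' p) s.
  by rewrite -{1}(iter_tauK R p); apply: same_orbit_iter.
by exists h; split=> s; rewrite oE; [apply: hint | apply: h1].
Qed.

Lemma cohomologous_sym f g : cohomologous f g -> cohomologous g f.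
Proof.
case=> h fgh; exists (fsinv h) => s; rewrite /intertwines !fsinvE.
by apply: (mulgI (h s)); rewrite mulVKg mulgA -fgh mulgK.
Qed.

Lemma cohomologous_trans f g k : cohomologous f g -> cohomologous g k -> cohomologous f k.
Proof.
case=> h fgh [h' gkh]; exists (fsmul h h') => s; rewrite /intertwines !fsmulE.
by rewrite mulgA fgh -!mulgA gkh.
Qed.

(** [Z] is invariant, so [h] may be cut along it: the part outside [Z] trivialises [f], the part
    inside trivialises [g]. *)
Lemma cohomologous_restrict (Z : S -> Prop) f g :
  (forall s, Z (tau s) <-> Z s) -> (forall s, Z s -> f s = 1) ->
  (forall s, ~ Z s -> g s = 1) -> cohomologous f g ->
  cohomologous f [fsfun] /\ cohomologous [fsfun] g.
Proof.
move=> Ztau fZ gZ [h fgh].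
pose r b : fsupp_fun S A := [fsfun s in finsupp h => if `[< Z s >] == b then h s else 1 | 1].
have rE b s : r b s = if `[< Z s >] == b then h s else 1.
  by rewrite fsfunE; case: ifPn => // nh; rewrite fsfun_dflt //; case: ifP.
split; [exists (r false) | exists (r true)] => s; have := fgh s;
  rewrite /intertwines !rE (asbool_equiv_eq (Ztau s)) fsfun0E.
  case: asboolP => [/Ztau/fZ -> //|/(contra_not (iffLR (Ztau s)))/gZ ->] //=.
case: asboolP => [/Ztau/fZ -> //|/(contra_not (iffLR (Ztau s)))/gZ ->] //=.
Qed.

End Orbits.

(** * Conjugacy in the wreath product *)

Section WreathConjugacy.
Variables (A B : groupType) (S : choiceType) (to : right_action B S).
Hypothesis mulgC : forall x y : B, x * y = y * x.
Implicit Types (f g h : fsupp_fun S A) (b c d : B) (s t : S).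

Definition cohomologous_by b := @cohomologous S A (to^~ b).

Lemma iter_ract b k s : iter k (to^~ b) s = to s (b ^+ k).
Proof. by elim: k => [|k IHk]; rewrite ?expg0 ?ract1 // iterS IHk expgSr ractM. Qed.

(** Conjugation by (d, h) amounts to (d, h) (c, g) = (b, f) (d, h). Commutativity of B reduces the
    first component to b = c, and the second one, read at [to s b], is the intertwining equation. *)
Lemma conjugate_wreath b c f g :
  conjugate ((b, f) : wreath A to) (c, g) <->
  b = c /\ exists d, cohomologous_by b (fstrans to f d) g.
Proof.
split=> [[[d h]] E|[<- [d [h fgh]]]].
  have {E} [bc E] : (d * c, fsmul (fstrans to h c) g) = (b * d, fsmul (fstrans to f d) h).
    by rewrite -[LHS]/(((d, h) : wreath A to) * ((c, g) : wreath A to)) E conjgE mulVKg.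
  have {bc} bc : b = c by apply: (mulIg d); rewrite -bc mulgC.
  split=> //; exists d, h => s; rewrite -bc in E.
  by have := congr1 (fun k : fsupp_fun S A => k (to s b)) E; rewrite !fsmulE (fstransE _ h) ractK.
exists (d, h); apply: (mulgI ((d, h) : wreath A to)); rewrite conjgE mulVKg.
congr pair; first exact: mulgC.
apply/fsfunP => s; rewrite /= !fsmulE (fstransE _ h).
by have := fgh (to s b^-1); rewrite /intertwines ractKV.
Qed.

Lemma fstrans1 f : fstrans to f 1 = f.
Proof. by apply/fsfunP => s; rewrite fstransE invg1 ract1. Qed.

Lemma fstransM f b c : fstrans to f (b * c) = fstrans to (fstrans to f b) c.
Proof. by apply/fsfunP => s; rewrite !fstransE invgM ractM. Qed.

Lemma cohomologous_fstrans b d f g :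
  cohomologous_by b f g -> cohomologous_by b (fstrans to f d) (fstrans to g d).
Proof.
case=> h fgh; exists (fstrans to h d) => s; rewrite /intertwines !fstransE.
by have := fgh (to s d^-1); rewrite /intertwines -!ractM mulgC.
Qed.

Lemma cohomologous_fstrans_pow b k f : cohomologous_by b f (fstrans to f (b ^+ k)).
Proof.
elim: k f => [|k IHk] f; rewrite ?expg0 ?fstrans1.
  by exists [fsfun] => s; rewrite /intertwines !fsfun0E mul1g mulg1.
rewrite expgS fstransM; apply: cohomologous_trans (IHk _).
(* For a single b take h = f^-1: the translate of f by b has at sb the value f(s), so both sides of
   the equation are 1. *)
by exists (fsinv f) => s; rewrite /intertwines fsinvE fstransE ractK mulgV fsinvE mulVg.
Qed.

Section Stabilizer.
Variable s0 : S.
Hypothesis to_trans : transitive_action to.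

Lemma ract_eq x y : (to s0 x = to s0 y) <-> to s0 (x * y^-1) = s0.
Proof.
split=> E; first by rewrite ractM E ractK.
by rewrite -{2}E -ractM mulgVK.
Qed.

(** Stabilisers of points in one orbit are conjugate, hence equal in an abelian group. Whether a
    power of b fixes a point can thus be tested at [s0] alone. *)
Lemma ract_fix x s : (to s x = s) <-> to s0 x = s0.
Proof.
have [c <-] := to_trans s0 s; rewrite -ractM mulgC ractM.
by split=> [/(can_inj (ractK to c))|->].
Qed.

Lemma eq_fstrans f x y : to s0 x = to s0 y -> fstrans to f x = fstrans to f y.
Proof.
move=> /ract_eq xy; apply/fsfunP => s; rewrite !fstransE; congr (f _).
by rewrite -[LHS](iffRL (ract_fix _ _) xy) -ractM mulKg.
Qed.

End Stabilizer.
End WreathConjugacy.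

(** * Words of the wreath product as lists of lamps *)

Section WreathWords.
Variables (A B : groupType) (S : choiceType) (to : right_action B S) (s0 : S).
Variables (m n : nat) (gA : 'I_m -> A) (gB : 'I_n -> B).
Hypothesis mulgC : forall x y : B, x * y = y * x.
Local Notation W := (wreath A to).
Local Notation gens := (wreath_gens to gA gB s0).
(* A function in A^(S) is represented by a list of pairs (p, a), each standing
   for the value of the word a placed at the point s0 * p; the values placed at
   the same point are multiplied in the order of the list. *)
Notation lamps := (seq (seq (letter n) * seq (letter m))).
Implicit Types (f g : fsupp_fun S A) (b : B) (s t : S) (p q : word n) (fl gl : lamps).

Definition letterB (l : letter (n + m)) : seq (letter n) :=
  if split l.1 is inl j then [:: (j, l.2)] else [::].

Definition letterA (l : letter (n + m)) : seq (letter m) :=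
  if split l.1 is inr j then [:: (j, l.2)] else [::].

(* Reading a word from the right, a lamp letter is placed at the point s0 * p
   where p is the B-part of the suffix read so far. *)
Definition parse (u : seq (letter (n + m))) : seq (letter n) * lamps :=
  foldr (fun l st => (letterB l ++ st.1, (st.1, letterA l) :: st.2)) ([::], [::]) u.

Definition lampfun fl : fsupp_fun S A :=
  foldr (fun x f => fsmul (fssingle (to s0 (weval gB x.1)) (weval gA x.2)) f) [fsfun] fl.

Lemma fssingleE s a t : fssingle s a t = (if t == s then a else 1) :> A.
Proof. by rewrite fsfunE inE. Qed.

Lemma lampfunE fl s :
  lampfun fl s = \prod_(x <- fl | to s0 (weval gB x.1) == s) weval gA x.2.
Proof.
elim: fl => [|x fl IHfl]; first by rewrite big_nil fsfun0E.
rewrite big_cons /= fsmulE IHfl fssingleE eq_sym.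
by case: ifP; rewrite ?mul1g.
Qed.

Lemma wreathM (b c : B) f g :
  ((b, f) : W) * ((c, g) : W) = ((b * c, fsmul (fstrans to f c) g) : W).
Proof. by []. Qed.

Lemma wreathV (b : B) f : ((b, f) : W)^-1 = ((b^-1, fsinv (fstrans to f b^-1)) : W).
Proof. by []. Qed.

Lemma weval_parse u : weval gens u = ((weval gB (parse u).1, lampfun (parse u).2) : W).
Proof.
elim: u => [|[i e] u IHu] //.
rewrite weval_cons IHu /= -/(parse u); move: (parse u) => [w fl] /=.
rewrite weval_cat /letterB /letterA /leval /wreath_gens /=.
case: (split i) => j /=.
  rewrite mulg1; case: e; rewrite /leval /= ?wreathV wreathM; congr pair.
    apply/fsfunP => s; rewrite !fsmulE fstransE fsinvE fstransE fsfun0E invg1 fssingleE.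
    by case: ifP.
  by apply/fsfunP => s; rewrite !fsmulE fstransE fsfun0E fssingleE; case: ifP.
case: e; rewrite /leval /= ?wreathV wreathM ?invg1 mul1g; congr pair;
  apply/fsfunP => s; rewrite !fsmulE fstransE ?fsinvE ?fstransE ?invg1 ?ract1 !fssingleE;
  rewrite mulg1 -(can2_eq (ractKV to _) (ractK to _)); case: ifP => _ //.
by rewrite invg1.
Qed.

Definition shift_lamps (d : seq (letter n)) fl : lamps := [seq (x.1 ++ d, x.2) | x <- fl].

Lemma lampfun_shift d fl : lampfun (shift_lamps d fl) = fstrans to (lampfun fl) (weval gB d).
Proof.
apply/fsfunP => s; rewrite fstransE !lampfunE big_map; apply: eq_bigl => x /=.
by rewrite weval_cat ractM (can2_eq (ractK to _) (ractKV to _)).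
Qed.

Definition points fl : seq (seq (letter n)) := [seq x.1 | x <- fl].

Lemma lampfun_out fl s : s \notin [seq to s0 (weval gB p) | p <- points fl] -> lampfun fl s = 1.
Proof.
move=> out; rewrite lampfunE big1_seq // => x /andP[/eqP xs xfl].
by case/negP: out; rewrite -xs -map_comp; apply/mapP; exists x.
Qed.


Hypothesis to_trans : transitive_action to.
(** Each listed product carries a point of [fl] to a point of [gl]; the empty word covers the case
    in which no orbits meet. *)
Definition candidates fl gl : seq (seq (letter n)) :=
  [::] :: flatten [seq [seq invw x.1 ++ y.1 | y <- gl] | x <- fl].

(* Two functions supported on disjoint unions of orbits of b are cohomologous
   only if both are cohomologous to the trivial function, and then the
   translation is irrelevant; otherwise some translate of a point of fl meets
   the orbit of a point of gl, which determines the translation up to a power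
   of b and the stabiliser. *)
Lemma cohomologous_candidates b fl gl :
  (exists d, cohomologous_by to b (fstrans to (lampfun fl) d) (lampfun gl)) <->
  (exists2 d, d \in candidates fl gl &
     cohomologous_by to b (fstrans to (lampfun fl) (weval gB d)) (lampfun gl)).
Proof.
split=> [[d fdg]|[d _ fdg]]; last by exists (weval gB d).
have tauK := ractK to b; have tauK' := ractKV to b.
pose pt p := to s0 (weval gB p).
have [[x [xfl [y [ygl xy]]]]|far] := pselect (exists x, x \in fl /\ exists y, y \in gl /\
    same_orbit (to^~ b) (to (pt x.1) d) (pt y.1)).
  exists (invw x.1 ++ y.1).
    by rewrite inE; apply/orP; right; apply/flatten_mapP; exists x => //; apply/mapP; exists y.
  rewrite weval_cat weval_inv.
  have same e : to (pt x.1) e = pt y.1 ->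
      fstrans to (lampfun fl) ((weval gB x.1)^-1 * weval gB y.1) = fstrans to (lampfun fl) e.
    rewrite /pt -ractM => E; apply: (eq_fstrans mulgC to_trans (s0 := s0)).
    by rewrite mulgC ractM -E -ractM mulgC mulKg.
  case: xy => k [] E.
    rewrite (same (d * b ^+ k)) ?fstransM; last by rewrite ractM -iter_ract.
    apply: cohomologous_trans fdg; apply/cohomologous_sym/cohomologous_fstrans_pow => //.
  rewrite (same (d * b ^- k)) ?fstransM; last by rewrite ractM E iter_ract ractK.
  apply: cohomologous_trans fdg.
  have := cohomologous_fstrans_pow to b k (fstrans to (fstrans to (lampfun fl) d) (b ^- k)).
  by rewrite -[fstrans _ _ (b ^+ k)]fstransM mulVg fstrans1.
exists [::]; first by rewrite inE eqxx.
rewrite fstrans1.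
(* The union of the orbits through the points of [gl]: the translated lamps of [fl] all lie outside
   it. *)
pose Z s := exists y, y \in gl /\ same_orbit (to^~ b) (pt y.1) s.
have mem_pts gl' s : s \in [seq to s0 (weval gB p) | p <- points gl'] ->
    exists x, x \in gl' /\ s = pt x.1.
  by rewrite -map_comp => /mapP[x xgl ->]; exists x.
have [fd1 g1] : cohomologous_by to b (fstrans to (lampfun fl) d) [fsfun] /\
    cohomologous_by to b [fsfun] (lampfun gl).
  apply: (cohomologous_restrict (Z := Z)) fdg => s.
  - split=> -[y [ygl ys]]; exists y; split=> //.
      by move: ys; rewrite (same_orbit_tau tauK).
    by rewrite (same_orbit_tau tauK).
  - case=> y [ygl [k ys]]; rewrite fstransE; apply/lampfun_out/negP => /mem_pts[x [xfl sx]].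
    apply: far; exists x; split=> //; exists y; split=> //; exists k.
    by rewrite -sx ractKV; case: ys; [right|left].
  - move=> nZ; apply/lampfun_out/negP => /mem_pts[y [ygl sy]].
    by apply: nZ; rewrite sy; exists y; split=> //; apply: same_orbit_refl.
apply: cohomologous_trans g1.
(* Translating back by d^-1 removes d from the left side and leaves the trivial function
   unchanged. *)
have := cohomologous_fstrans mulgC d^-1 fd1; rewrite -fstransM mulgV fstrans1.
by congr cohomologous_by; apply/fsfunP => s; rewrite fstransE !fsfun0E.
Qed.

Definition embedB (w : word n) : word (n + m) := [seq (lshift m l.1, l.2) | l <- w].
Definition embedA (w : word m) : word (n + m) := [seq (rshift n l.1, l.2) | l <- w].

Lemma weval_embedB w : weval gens (embedB w) = wreath_base A to (weval gB w).
Proof.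
elim: w => // -[i e] w IHw; rewrite /embedB map_cons -/(embedB w) !weval_cons IHw.
rewrite /leval /wreath_gens /= -[lshift m i]/(unsplit (inl i)) unsplitK.
by case: e; rewrite ?wreathV wreathM; congr pair; apply/fsfunP => s;
  rewrite fsmulE !fstransE ?fsinvE ?fstransE !fsfun0E ?invg1 mulg1.
Qed.

Lemma weval_embedA w : weval gens (embedA w) = wreath_lamp to s0 (weval gA w).
Proof.
elim: w => [|[i e] w IHw].
  by congr pair; apply/fsfunP => s; rewrite fsfun0E fssingleE; case: ifP.
rewrite /embedA map_cons -/(embedA w) !weval_cons IHw.
rewrite /leval /wreath_gens /= -[rshift n i]/(unsplit (inr i)) unsplitK.
by case: e; rewrite ?wreathV wreathM ?invg1 mulg1; congr pair; apply/fsfunP => s;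
  rewrite fsmulE !fstransE ?fsinvE ?fstransE ?invg1 !ract1 !fssingleE; case: ifP => _;
  rewrite ?invg1 ?mulg1.
Qed.

(** By transitivity a lamp at any point is a conjugate of one at [s0] by a base element; a function
    of finite support is then peeled off point by point. *)
Lemma wreath_generates : generates gA -> generates gB -> generates gens.
Proof.
move=> A_gen B_gen.
pose im (x : W) := exists w, weval gens w = x.
have imM x y : im x -> im y -> im (x * y).
  by case=> u <- [v <-]; exists (u ++ v); rewrite weval_cat.
have imB b : im (wreath_base A to b).
  by have [w <-] := B_gen b; exists (embedB w); rewrite weval_embedB.
have imL s a : im (wreath_lamp to s a).
  have [b <-] := to_trans s0 s; have [w <-] := A_gen a.
  have -> : wreath_lamp to (to s0 b) (weval gA w) =
      wreath_base A to b^-1 * wreath_lamp to s0 (weval gA w) * wreath_base A to b.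
    rewrite !wreathM mulg1 mulVg; congr pair; apply/fsfunP => s'.
    rewrite !(fsmulE, fstransE) !fsfun0E mul1g mulg1 !fssingleE.
    by rewrite (can2_eq (ractKV to _) (ractK to _)).
  apply: (imM _ _ _ (imB b)); apply: (imM _ _ (imB _)).
  by exists (embedA w); rewrite weval_embedA.
have imF (xs : seq S) f : (forall s, s \notin xs -> f s = 1) -> im ((1, f) : W).
  elim: xs f => [|x xs IHxs] f out.
    by exists [::]; congr pair; apply/fsfunP => s; rewrite fsfun0E out.
  have -> : ((1, f) : W) = wreath_lamp to x (f x) * ((1, fsmul (fssingle x (f x)^-1) f) : W).
    rewrite wreathM mulg1; congr pair; apply/fsfunP => s.
    rewrite fsmulE fstransE invg1 ract1 fsmulE !fssingleE.
    by case: ifP => [/eqP ->|_]; rewrite ?mulVKg ?mul1g.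
  apply: (imM _ _ (imL _ _)); apply: IHxs => s sxs; rewrite fsmulE fssingleE.
  case: eqP => [->|/eqP sx]; first by rewrite mulVg.
  by rewrite mul1g out // inE negb_or sx.
case=> b f; have -> : ((b, f) : W) = wreath_base A to b * ((1, f) : W).
  by rewrite wreathM mulg1; congr pair; apply/fsfunP => s; rewrite fsmulE fstransE fsfun0E mul1g.
apply: (imM _ _ (imB _)); apply: (imF (finsupp f)) => s; exact: fsfun_dflt.
Qed.

End WreathWords.

(** * The decision procedure *)

Lemma computable_lift X Y Z `{coding X} `{coding Y} `{coding Z} (f : X -> Z) :
  computable f -> computable (fun p : X * Y => f p.1).
Proof. by move=> cf; apply: (computable_comp cf); computable_path. Qed.

Section Algorithm.
Variables (m n : nat).
Local Notation wordB := (seq (letter n)).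
Local Notation wordA := (seq (letter m)).
Local Notation lamps := (seq (wordB * wordA)).
Variables (memB mem : wordB -> bool) (bound : wordB -> nat) (M : nat).
Variable conj : wordA -> wordA -> bool.

(** The word in A found at the point s0 * q: the membership test says that [q] and [x.1] send [s0]
    to the same point. *)
Definition lamp_word (fl : lamps) (q : wordB) : wordA :=
  flatten [seq x.2 | x <- [seq x <- fl | mem (q ++ invw x.1)]].

Definition orbit_word (b : wordB) (fl : lamps) (q : wordB) (L : nat) : wordA :=
  flatten [seq lamp_word fl (q ++ wpow b j) | j <- iota 1 L].

(** Used only when the M-th power of [b] fixes [s0]. The list then contains [M], and the value 1 is
    a mere default. *)
Definition order_mod (b : wordB) : nat :=
  if [seq k <- iota 1 M | mem (wpow b k)] is k :: _ then k else 1.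

(** If b^k moves the point of [p] to that of [q], then p q^-1 b^k fixes [s0], so on infinite orbits
    [bound] limits k. The sum dominates all these limits and the successor makes the inequality
    strict. *)
Definition radius (ps : seq wordB) : nat :=
  (sumn [seq sumn [seq bound (p ++ invw q) | q <- ps] | p <- ps]).+1.

Definition periodic_test (b : wordB) (fl gl : lamps) (p : wordB) : bool :=
  conj (orbit_word b fl p (order_mod b)) (orbit_word b gl p (order_mod b)).

(* The window of 2R points around p contains all the points of the supports that
   lie in the orbit of p; equality in A is conjugacy of the quotient to 1. *)
Definition aperiodic_test (b : wordB) (fl gl : lamps) (R : nat) (p : wordB) : bool :=
  let q := p ++ wpow (invw b) R in
  conj (orbit_word b fl q (R + R) ++ invw (orbit_word b gl q (R + R))) [::].

(** By the choice of [M], the orbits of [b] are finite exactly when its M-th power fixes [s0]. *)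
Definition cohomologous_test (b : wordB) (fl gl : lamps) : bool :=
  if mem (wpow b M) then all (periodic_test b fl gl) (points (fl ++ gl))
  else all (aperiodic_test b fl gl (radius (points (fl ++ gl)))) (points (fl ++ gl)).

Definition conjugate_test (u v : seq (letter (n + m))) : bool :=
  memB ((parse u).1 ++ invw (parse v).1) &&
  has (fun d => cohomologous_test (parse u).1 (shift_lamps d (parse u).2) (parse v).2)
    (candidates (parse u).2 (parse v).2).

Hypotheses (cmemB : computable memB) (cmem : computable mem) (cbound : computable bound).
Hypothesis cconj : computable (fun p : wordA * wordA => conj p.1 p.2).

Lemma computable_conj X `{coding X} (u v : X -> wordA) :
  computable u -> computable v -> computable (fun x => conj (u x) (v x)).
Proof. by move=> cu cv; apply: computable_comp cconj (computable_pair cu cv). Qed.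

Lemma computable_invw X k `{coding X} (w : X -> seq (letter k)) :
  computable w -> computable (fun x => invw (w x)).
Proof.
move=> cw; apply/computable_rev/(computable_map (f := fun _ => @invl k)) => //.
by apply: (computable_comp (computable_letter _)); computable_path.
Qed.

Lemma computable_wpow X k `{coding X} (w : X -> seq (letter k)) (j : X -> nat) :
  computable w -> computable j -> computable (fun x => wpow (w x) (j x)).
Proof.
move=> cw cj; apply: (computable_iter (f := fun x => cat (w x))) => //; last exact: computable_const.
apply: computable_cat; last by computable_path.
by apply: (computable_comp cw); computable_path.
Qed.

Lemma computable_lamp_word X `{coding X} (fl : X -> lamps) (q : X -> wordB) :
  computable fl -> computable q -> computable (fun x => lamp_word (fl x) (q x)).
Proof.
move=> cfl cq; apply/computable_flatten/(computable_map (f := fun _ y => y.2)).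
  by computable_path.
apply: (computable_filter (f := fun x y => mem (q x ++ invw y.1))) => //.
apply: (computable_comp cmem); apply: computable_cat.
  by apply: (computable_comp cq); computable_path.
by apply: computable_invw; computable_path.
Qed.
Lemma computable_orbit_word X `{coding X} (b : X -> wordB) (fl : X -> lamps)
    (q : X -> wordB) (L : X -> nat) :
  computable b -> computable fl -> computable q -> computable L ->
  computable (fun x => orbit_word (b x) (fl x) (q x) (L x)).
Proof.
move=> cb cfl cq cL; apply/computable_flatten.
apply: (computable_map (f := fun x j => lamp_word (fl x) (q x ++ wpow (b x) j))); last first.
  by apply: computable_iota => //; exact: computable_const.
apply: computable_lamp_word; first by apply: (computable_comp cfl); computable_path.
apply: computable_cat; first by apply: (computable_comp cq); computable_path.
by apply: computable_wpow; [apply: (computable_comp cb)|]; computable_path.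
Qed.

Lemma computable_order_mod X `{coding X} (b : X -> wordB) :
  computable b -> computable (fun x => order_mod (b x)).
Proof.
move=> cb; apply: (computable_case_seq (f := fun _ k _ => k)); computable_path.
apply: (computable_filter (f := fun x k => mem (wpow (b x) k))); computable_path.
apply: (computable_comp cmem).
by apply: computable_wpow; [apply: (computable_comp cb)|]; computable_path.
Qed.

Lemma computable_radius X `{coding X} (ps : X -> seq wordB) :
  computable ps -> computable (fun x => radius (ps x)).
Proof.
move=> cps; apply/computable_succ/computable_sumn.
apply: (computable_map (f := fun x p => sumn [seq bound (p ++ invw q) | q <- ps x])) => //.
apply/computable_sumn/(computable_map (f := fun (x : X * wordB) q => bound (x.2 ++ invw q))); last first.
  by apply: (computable_comp cps); computable_path.
apply: (computable_comp cbound); apply: computable_cat; first by computable_path.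
by apply: computable_invw; computable_path.
Qed.

Lemma computable_points X `{coding X} (fl : X -> lamps) :
  computable fl -> computable (fun x => points (fl x)).
Proof. by move=> cfl; apply: (computable_map (f := fun _ y => y.1)); computable_path. Qed.

Lemma computable_shift_lamps X `{coding X} (d : X -> wordB) (fl : X -> lamps) :
  computable d -> computable fl -> computable (fun x => shift_lamps (d x) (fl x)).
Proof.
move=> cd cfl; apply: (computable_map (f := fun x y => (y.1 ++ d x, y.2))) => //.
apply: computable_pair; last by computable_path.
by apply: computable_cat; [|apply: (computable_comp cd)]; computable_path.
Qed.

Lemma computable_candidates X `{coding X} (fl gl : X -> lamps) :
  computable fl -> computable gl -> computable (fun x => candidates (fl x) (gl x)).
Proof.
move=> cfl cgl; apply: computable_cons; first exact: computable_const.
apply/computable_flatten.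
apply: (computable_map (f := fun z x => [seq invw x.1 ++ y.1 | y <- gl z])) => //.
apply: (computable_map (f := fun (z : X * (wordB * wordA)) y => invw z.2.1 ++ y.1)).
  by apply: computable_cat; [apply: computable_invw|]; computable_path.
by apply: (computable_comp cgl); computable_path.
Qed.

Lemma computable_cohomologous_test X `{coding X} (b : X -> wordB) (fl gl : X -> lamps) :
  computable b -> computable fl -> computable gl ->
  computable (fun x => cohomologous_test (b x) (fl x) (gl x)).
Proof.
move=> cb cfl cgl.
have cps : computable (fun x => points (fl x ++ gl x)).
  by apply/computable_points/computable_cat.
apply: computable_if.
- by apply/(computable_comp cmem)/computable_wpow => //; apply: computable_const.
- apply: (computable_all (f := fun x => periodic_test (b x) (fl x) (gl x))) => //.
  by apply: computable_conj; apply: computable_orbit_word;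
    try apply: computable_order_mod; try exact: computable_lift; computable_path.
- apply: (computable_all (f := fun x =>
    aperiodic_test (b x) (fl x) (gl x) (radius (points (fl x ++ gl x))))) => //.
  have cr : computable (fun x => radius (points (fl x ++ gl x))) by apply: computable_radius.
  apply: computable_conj; last exact: computable_const.
  apply: computable_cat; [|apply: computable_invw];
    (apply: computable_orbit_word; [exact: computable_lift|exact: computable_lift| |
       by apply: computable_addn; apply: (computable_lift cr)]);
    apply: computable_cat; try apply: computable_wpow; try apply: computable_invw;
    try exact: computable_lift;
     try apply: (computable_lift cr); computable_path.
Qed.

Lemma computable_parse X `{coding X} (u : X -> seq (letter (n + m))) :
  computable u -> computable (fun x => parse (u x)).
Proof.
move=> cu; apply: (computable_foldr (f := fun _ l (st : wordB * lamps) =>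
  (letterB l ++ st.1, (st.1, letterA l) :: st.2))) => //; last exact: computable_const.
apply: computable_pair.
  apply: computable_cat; last by computable_path.
  by apply: (computable_comp (computable_letter (@letterB m n))); computable_path.
apply: computable_cons; computable_path.
by apply: (computable_comp (computable_letter (@letterA m n))); computable_path.
Qed.

Lemma computable_conjugate_test :
  computable (fun p : seq (letter (n + m)) * seq (letter (n + m)) => conjugate_test p.1 p.2).
Proof.
have c1 : computable (fun p : seq (letter (n + m)) * seq (letter (n + m)) => parse p.1).
  by apply: computable_parse; computable_path.
have c2 : computable (fun p : seq (letter (n + m)) * seq (letter (n + m)) => parse p.2).
  by apply: computable_parse; computable_path.
apply: computable_andb.
  apply/(computable_comp cmemB)/computable_cat; first exact: computable_fst.
  by apply: computable_invw; exact: computable_fst.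
apply: (computable_has (f := fun p d => cohomologous_test (parse p.1).1
  (shift_lamps d (parse p.1).2) (parse p.2).2)); last first.
  by apply: computable_candidates; apply: computable_snd.
apply: computable_cohomologous_test.
- by apply/computable_fst/(computable_comp c1); computable_path.
- apply: computable_shift_lamps; first by computable_path.
  by apply/computable_snd/(computable_comp c1); computable_path.
- by apply/computable_snd/(computable_comp c2); computable_path.
Qed.

End Algorithm.

(** * Correctness of the decision procedure *)

Section Correctness.
Variables (A B : groupType) (S : choiceType) (to : right_action B S) (s0 : S).
Variables (m n : nat) (gA : 'I_m -> A) (gB : 'I_n -> B).
Hypothesis mulgC : forall x y : B, x * y = y * x.
Hypothesis to_trans : transitive_action to.
Local Notation wordB := (seq (letter n)).
Local Notation wordA := (seq (letter m)).
Local Notation lamps := (seq (wordB * wordA)).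
Variables (memB mem : wordB -> bool) (bound : wordB -> nat) (M : nat).
Variable conj : wordA -> wordA -> bool.
Hypothesis memBP : forall w, memB w <-> weval gB w = 1.
Hypothesis memP : forall w, mem w <-> to s0 (weval gB w) = s0.
Hypothesis M_gt0 : 0 < M.
Hypothesis orderP : forall w k, 0 < k -> to s0 (weval gB w ^+ k) = s0 ->
  to s0 (weval gB w ^+ M) = s0.
Hypothesis boundP : forall u w k, to s0 (weval gB w ^+ M) <> s0 ->
  to s0 (weval gB u * weval gB w ^+ k) = s0 -> k <= bound u.
Hypothesis conjP : forall u v, conj u v <-> conjugate (weval gA u) (weval gA v).
Implicit Types (b p q : wordB) (fl gl : lamps).
Local Notation lampfun := (lampfun to s0 gA gB).

Lemma weval_lamp_word fl q :
  weval gA (lamp_word mem fl q) = lampfun fl (to s0 (weval gB q)).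
Proof.
rewrite weval_flatten big_map big_filter lampfunE; apply: eq_bigl => x.
apply/idP/eqP => [/memP|E].
  by rewrite weval_cat weval_inv => /ract_eq.
by apply/memP; rewrite weval_cat weval_inv; apply/ract_eq.
Qed.

Lemma weval_orbit_word b fl q L : weval gA (orbit_word mem b fl q L) =
  orbprod (to^~ (weval gB b)) (lampfun fl) (to s0 (weval gB q)) L.
Proof.
rewrite weval_flatten big_map; apply: eq_bigr => j _.
by rewrite weval_lamp_word weval_cat ractM weval_pow iter_ract.
Qed.

Lemma order_modP b : mem (wpow b M) ->
  [/\ 0 < order_mod mem M b, to s0 (weval gB b ^+ order_mod mem M b) = s0 &
    forall k, 0 < k < order_mod mem M b -> to s0 (weval gB b ^+ k) <> s0].
Proof.
move=> bM; rewrite /order_mod.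
have [in_s sorted_s] : (forall k, (k \in [seq k <- iota 1 M | mem (wpow b k)]) =
     (0 < k <= M) && mem (wpow b k)) /\ sorted ltn [seq k <- iota 1 M | mem (wpow b k)].
  split; first by move=> k; rewrite mem_filter mem_iota andbC add1n ltnS.
  by apply: sorted_filter (iota_ltn_sorted _ _); apply: ltn_trans.
case: [seq k <- iota 1 M | mem (wpow b k)] in_s sorted_s => [|N r] in_s sorted_s.
  by have := in_s M; rewrite in_nil M_gt0 leqnn bM.
have := in_s N; rewrite mem_head => /esym/andP[/andP[N_gt0 leNM] /memP].
rewrite weval_pow => bN; split=> // k /andP[k_gt0 ltkN].
rewrite -weval_pow => /memP bk.
have : k \in N :: r by rewrite in_s k_gt0 bk (leq_trans (ltnW ltkN)).
rewrite inE => /predU1P[kN|kr]; first by rewrite kN ltnn in ltkN.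
have /allP/(_ k kr) := order_path_min ltn_trans sorted_s.
by rewrite /= ltnNge (ltnW ltkN).
Qed.

Lemma leq_radius ps p q : p \in ps -> q \in ps -> bound (p ++ invw q) < radius bound ps.
Proof.
move=> pps qps; rewrite /radius ltnS.
have le_sumn (f : wordB -> nat) x s : x \in s -> f x <= sumn (map f s).
  by move=> xs; rewrite sumnE big_map (big_rem x) //= leq_addr.
exact: leq_trans (le_sumn (fun q => bound (p ++ invw q)) _ _ qps)
  (le_sumn (fun p => sumn [seq bound (p ++ invw q) | q <- ps]) _ _ pps).
Qed.

Lemma conjugateE (x y : A) : conjugate x y <-> exists z, x * z = z * y.
Proof.
split=> -[z E]; exists z; first by rewrite E conjgE mulVKg.
by rewrite conjgE E mulKg.
Qed.

Lemma cohomologous_testP b fl gl : cohomologous_test mem bound M conj b fl gl <->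
  cohomologous_by to (weval gB b) (lampfun fl) (lampfun gl).
Proof.
set ps := points (fl ++ gl); pose pt p := to s0 (weval gB p).
have supp s : s \notin map pt ps -> lampfun fl s = 1 /\ lampfun gl s = 1.
  by rewrite /ps /points !map_cat mem_cat negb_or => /andP[? ?];
    split; apply: lampfun_out.
have tauK := ractK to (weval gB b); have tauK' := ractKV to (weval gB b).
rewrite /cohomologous_test -/ps; case: ifPn => [bM|/negP bM].
  have [N_gt0 bN minN] := order_modP bM.
  have [||pr1 pr2] := cohomologous_periodic tauK N_gt0 _ _ supp.
  - by move=> q; rewrite iter_ract; apply/(ract_fix mulgC s0 to_trans).
  - by move=> q k /minN nk; rewrite iter_ract => /(ract_fix mulgC s0 to_trans).
  split=> [/allP test|/pr1 sol].
    apply: pr2 => _ /mapP[p /test pt_p ->]; apply/conjugateE.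
    by move: pt_p => /conjP; rewrite !weval_orbit_word.
  apply/allP => p pps; apply/conjP/conjugateE; rewrite !weval_orbit_word.
  exact/sol/map_f.
have nper (q : S) k : 0 < k -> iter k (to^~ (weval gB b)) q <> q.
  move=> k_gt0; rewrite iter_ract => /(ract_fix mulgC s0 to_trans)/(orderP k_gt0) E.
  by apply: bM; apply/memP; rewrite weval_pow.
have bd (p q : S) k : p \in map pt ps -> q \in map pt ps ->
    q = iter k (to^~ (weval gB b)) p ->
    k < radius bound ps.
  move=> /mapP[p' pps ->] /mapP[q' qps ->]; rewrite iter_ract => E.
  apply: leq_ltn_trans (leq_radius pps qps).
  apply: (@boundP _ b); first by move=> E'; apply: bM; apply/memP; rewrite weval_pow.
  rewrite weval_cat weval_inv -mulgA [_^-1 * _]mulgC mulgA.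
  by apply/ract_eq; rewrite ractM; apply: esym E.
set R := radius bound ps in bd *; set tau' := to^~ (weval gB b)^-1.
have [ap1 ap2] := cohomologous_aperiodic tauK tauK' nper bd supp.
have testE p : aperiodic_test mem conj b fl gl R p <->
    orbprod (to^~ (weval gB b)) (lampfun fl) (iter R tau' (pt p)) (R + R) =
    orbprod (to^~ (weval gB b)) (lampfun gl) (iter R tau' (pt p)) (R + R).
  have qE : iter R tau' (pt p) = to s0 (weval gB (p ++ wpow (invw b) R)).
    by rewrite /tau' iter_ract weval_cat weval_pow weval_inv ractM.
  rewrite qE -!weval_orbit_word; apply: (iff_trans (conjP _ _)).
  rewrite weval_cat weval_inv; split=> [[z /= E]|->]; last first.
    by exists 1; rewrite mulgV conj1g.
  by apply: divg1_eq; apply: (conjg_inj z); rewrite -E conj1g.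
split=> [/allP test|/ap1 sol].
  by apply: ap2 => _ /mapP[p /test/testE E ->].
by apply/allP => p pps; apply/testE/sol/map_f.
Qed.

Lemma conjugate_testP u v : conjugate_test memB mem bound M conj u v <->
  conjugate (weval (wreath_gens to gA gB s0) u) (weval (wreath_gens to gA gB s0) v).
Proof.
rewrite !weval_parse conjugate_wreath // /conjugate_test.
move: (parse u) (parse v) => x y.
have bcE : memB (x.1 ++ invw y.1) <-> weval gB x.1 = weval gB y.1.
  rewrite memBP weval_cat weval_inv.
  by split=> [/divg1_eq|->]; rewrite ?mulgV.
rewrite cohomologous_candidates //; split.
  case/andP=> /bcE bc /hasP[d dc /cohomologous_testP]; rewrite lampfun_shift => fdg.
  by split=> //; exists d.
case=> bc [d dc fdg]; apply/andP; split; first exact/bcE.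
by apply/hasP; exists d => //; apply/cohomologous_testP; rewrite lampfun_shift.
Qed.

End Correctness.

Theorem corollary1p0p8
    (A B : groupType) (S : choiceType) (to : right_action B S) (s0 : S)
    (m n : nat) (gA : 'I_m -> A) (gB : 'I_n -> B)
    (A_nontrivial : exists x : A, x <> 1)
    (B_nontrivial : exists x : B, x <> 1)
    (A_recpres : recursively_presented A)
    (A_conj : conjugacy_problem_solvable gA)
    (B_gen : generates gB)
    (B_abelian : forall x y : B, x * y = y * x)
    (to_trans : transitive_action to) :
  conjugacy_problem_solvable (wreath_gens to gA gB s0).
Proof.
case: A_conj => A_gen [fA [rfA fAP]]; split.
  exact: wreath_generates.
(* For the trivial subgroup, membership is the word problem of B. *)
have [|x y -> ->|memB [_ [_ [_ [cmemB _ memBP _ _]]]]] :=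
  @subgroup_decidable B n gB B_abelian (eq^~ 1); rewrite ?mulgV //.
have [|x y sx sy|mem [bound [M [M_gt0 [cmem cbound memP orderP boundP]]]]] :=
  @subgroup_decidable B n gB B_abelian (fun x => to s0 x = s0).
- exact: ract1.
- by apply/ract_eq; rewrite sx sy.
pose conj (u v : seq (letter m)) := fA [tuple word_code u; word_code v] == 1%N.
have conjP u v : conj u v <-> conjugate (weval gA u) (weval gA v).
  rewrite /conj; have [f1 f0] := fAP u v.
  split=> [/eqP E|/f1 -> //]; have [//|/f0] := pselect (conjugate (weval gA u) (weval gA v)).
  by rewrite E.
have cconj : computable (fun p : seq (letter m) * seq (letter m) => conj p.1 p.2).
  apply: (computable_eqn (f := fun p => fA [tuple word_code p.1; word_code p.2]));
    last exact: computable_const.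
  apply: (computable_nat2 (op := fun x y => fA [tuple x; y])
    (f := fun p => word_code p.1) (g := fun p => word_code p.2)).
  - apply: recursive_ext rfA _ => v; congr fA; apply: eq_from_tnth => i.
    by rewrite !(tnth_nth 0); case: i => -[|[|]].
  - apply: (computable_ext (f := fun p : seq (letter m) * seq (letter m) => encode p.1)).
      by apply/computable_encode; computable_path.
    by move=> p; rewrite -encode_word.
  - apply: (computable_ext (f := fun p : seq (letter m) * seq (letter m) => encode p.2)).
      by apply/computable_encode; computable_path.
    by move=> p; rewrite -encode_word.
have [g rg gE] := computable_conjugate_test M cmemB cmem cbound cconj.
(* The procedure acts on the code of a pair of words; pairing the two arguments turns it into the
   required binary function. *)
exists (fun v => g (pairn (coord 2 0 v) (coord 2 1 v))); split.
  exact: recursive_app1 rg recursive2_pairn.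
move=> u v.
have testP := conjugate_testP B_abelian to_trans
  memBP memP M_gt0 orderP boundP conjP u v.
have -> : g (pairn (word_code u) (word_code v)) = conjugate_test memB mem bound M conj u v.
  by rewrite -!encode_word (gE (u, v)).
by split=> [/testP ->|/testP/negP/negPf ->].
Qed.
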